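(* For Lebesgue almost every $\beta\in(1,2)$, and for Lebesgue almost every $x\in I_\beta$, \[ \limsup_{n\to\infty}\frac1n\log\big(\mathcal N_n(x;\beta)\big)=\log\left(\frac2\beta\right). \] For Lebesgue almost every $\beta\in(1,\sqrt2)$, and for Lebesgue almost every $x\in I_\beta$, \[ \lim_{n\to\infty}\frac1n\log\big(\mathcal N_n(x;\beta)\big)=\log\left(\frac2\beta\right). \]
   Context: For $\beta\in(1,2)$ let $I_\beta:=\left[0,\frac{1}{\beta-1}\right]$. A $\beta$-expansion of $x\in I_\beta$ is a sequence $(x_i)_{i\ge1}\in\{0,1\}^{\mathbb N}$ with $x=\sum_{i=1}^\infty x_i\beta^{-i}$. For $n\in\mathbb N$ put \[ \mathcal E^n_\beta(x):=\Big\{(x_1,\dots,x_n)\in\{0,1\}^n : \exists (x_{n+1},x_{n+2},\dots)\in\{0,1\}^{\mathbb N}\text{ with } x=\sum_{k=1}^\infty x_k\beta^{-k}\Big\}, \] and $\mathcal N_n(x;\beta):=|\mathcal E^n_\beta(x)|$, the number of words of length $n$ that can be extended to $\beta$-expansions of $x$. *)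

(* Defs.v *)
From HB Require Import structures.
From mathcomp Require Import all_boot all_order all_algebra.
From mathcomp Require Import all_classical all_reals all_analysis.

Set Implicit Arguments.
Unset Strict Implicit.
Unset Printing Implicit Defensive.

Import Order.TTheory GRing.Theory Num.Theory.
Import numFieldNormedType.Exports.

Local Open Scope ring_scope.

(* Digit sequences are indexed from 0: d k stands for the digit x_(k+1), *)
(* hence the exponent k.+1 below.                                        *)
Definition beta_expansion (R : realType) (beta x : R) (d : nat -> bool) : Prop :=
  (series (fun k : nat => (d k)%:R * beta ^- k.+1) @ \oo --> x)%classic.

Definition beta_interval (R : realType) (beta : R) : set R :=
  [set` `[0, (beta - 1)^-1]]%classic.

Definition beta_prefixes (R : realType) (n : nat) (beta x : R) :
    {set n.-tuple bool} :=
  [set w : n.-tuple bool |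
    `[< exists d : nat -> bool,
          beta_expansion beta x d /\ (forall i : 'I_n, tnth w i = d i) >]]%SET.

Definition prefix_count (R : realType) (n : nat) (x beta : R) : nat :=
  #|beta_prefixes n beta x|.

Definition growth_rate (R : realType) (x beta : R) (n : nat) : R :=
  n%:R^-1 * ln (prefix_count n x beta)%:R.

(* Main.v *)
Require Import Defs.
From HB Require Import structures.
From mathcomp Require Import all_boot all_order all_algebra.
From mathcomp Require Import all_classical all_reals all_analysis.
From mathcomp Require Import measurable_realfun.
From mathcomp Require Import ring lra zify.

Import Order.TTheory GRing.Theory Num.Theory.
Import numFieldNormedType.Exports.

Local Open Scope classical_set_scope.
Local Open Scope ring_scope.

(** Write c = 1/(b-1) and let P_w be the sum of the w_i b^-i over a word w. A
remainder is the value of some digit sequence exactly when it lies in [0, c], so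
a word w of length n extends to an expansion of x if and only if b^n (x - P_w)
lies in [0, c]. Hence the number N_n(x) of such words is the n-th iterate of
the operator f |-> f(b x) + f(b x - 1), applied to the indicator of [0, c]
([prefix_countE]). Half of this operator fixes the distribution function F of
the Bernoulli convolution, the law of the sum of b^-k e_k with independent fair
digits e_k. As the operator is positive, pointwise inequalities between the
indicator and increments of F carry over to all n ([branch_count_upper],
[branch_count_lower]):

  2^-n N_n(x) <= F(x + c b^-n) - F(x - 2 c b^-n),
  2^-n N_n(x) >= F(x + e b^-n) - F(x) - F(e) (F(x + (e + c) b^-n) - F(x)).

Since F(e) = o(e) as e decreases to 0 ([bcdf_small]; here b < 2 is used), N_n(x)
is of exact order (2/b)^n at each point x where F has a positive derivative.
Growth at b x or at b x - 1 forces growth at x, and a zero-one law based on the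
Lebesgue density theorem ([ae_hit]) spreads the lower bound from a set of
positive measure to almost every point of [0, c]. So the limit exists for almost
every x as soon as F is absolutely continuous ([ae_growth_rate_cvg]), and this
is shown for almost every b in (1, 2); the first part of the theorem only
records the upper limit, and the second part only uses b < sqrt 2.

Absolute continuity is obtained by transversality, in the manner of Solomyak and
of Peres and Solomyak. If the difference quotients of F over some lengths r
tending to 0 are bounded in L2, then the measure of F is absolutely continuous
([nu_null], [cdf_density]). The squared norm of such a quotient is at most of
the order of the probability, divided by r, that two independent sums are within
2 r of each other, and it only increases when digits are dropped
([autocorr_subseq], [increment_energy]). Keep the digits at the positions p k,
for k in a pattern of exponents, and put t = b^p. Given the first position at
which the two sums differ, the remaining difference, divided by its first term
and multiplied by t^4, is t^4 plus a combination of lower powers with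
coefficients in {-1, 0, 1}; it has slope bounded below in t, for all t >= 1.57
if all exponents are kept and for all t >= 1.41 if every third one is dropped
([expanding_from2], [expanding_from3]). So the set of bases for which it is of
size r has measure O(r t^k). Summed over k against the probability of no earlier
difference this gives O(r) ([walk_mass_gap_blocks]), because t < 2 in the
first case and t^3 < 4 in the second. Some power of each b lies in one of the two
ranges ([power_in_window]), and Fatou's lemma gives the bound along a sequence of
scales for almost every b ([ae_energy_bounded]). *)

(** * Transversality: sparse sums with a nonzero first term move with the base *)

(** With D = 2 these are all exponents from k on; with D = 3 every third one is
left out. The sparse pattern has only two coins per factor base^3, which is
enough below base 4^(1/3), and in exchange its sums stay transversal for bases
too small for the full pattern. *)
Fixpoint gap_blocks (D k N : nat) : seq nat :=
  if N is N'.+1 then [:: k, k.+1 & gap_blocks D (k + D) N'] else [::].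

Lemma gap_blocksS D k N :
  gap_blocks D k N.+1 = [:: k, k.+1 & gap_blocks D (k + D) N].
Proof. by []. Qed.

Section expanding.
Context {R : realFieldType}.
Implicit Types (a b x : R) (D k t N : nat).

(** Multiplied by a^(k+4), a sum of terms e_i a^-i with first term a^-k turns
into a^4 plus lower terms; the spread bounds the change of those lower terms
between b and a for all coefficients e_i in {-1,0,1}. The offset 4 is what
lets a^4 win: the terms with i < k + 4 become low positive powers of a, the term
i = k + 4 a constant, and the others small negative powers. *)
Definition spread k (l : seq nat) a b : R :=
  \sum_(i <- l) `|a ^+ (k + 4) / a ^+ i - b ^+ (k + 4) / b ^+ i|.

Lemma spread_cons k i l a b : spread k (i :: l) a b =
  `|a ^+ (k + 4) / a ^+ i - b ^+ (k + 4) / b ^+ i| + spread k l a b.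
Proof. by rewrite /spread big_cons. Qed.

Lemma spread_ge0 k l a b : 0 <= spread k l a b.
Proof. by apply: sumr_ge0. Qed.

Lemma spread_shift k t D N a b : 0 < a -> 0 < b ->
  spread k (gap_blocks D (k + t) N) a b = spread 0 (gap_blocks D t N) a b.
Proof.
move=> a0 b0; have E (x : R) (i : nat) : 0 < x ->
    x ^+ (k + 4) / x ^+ (k + i) = x ^+ (0 + 4) / x ^+ i.
  move=> x0; rewrite add0n !exprD invfM.
  have xk : x ^+ k != 0 by rewrite expf_neq0// gt_eqF.
  by rewrite mulrACA divff// mul1r.
elim: N t => [|N IH] t; first by rewrite /spread !big_nil.
by rewrite /= -addnS -addnA !spread_cons IH !E.
Qed.

Lemma spread_mono D t N a b :
  spread 0 (gap_blocks D t N) a b <= spread 0 (gap_blocks D t N.+1) a b.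
Proof.
elim: N t => [|N IH] t; first by rewrite [leLHS]big_nil spread_ge0.
by rewrite (gap_blocksS D _ N.+1) (gap_blocksS D _ N) 4!spread_cons !lerD2l; exact: IH.
Qed.

Lemma exprV_lip x a b n : 0 < x -> x * b >= 1 -> b <= a ->
  (b ^+ n)^-1 - (a ^+ n)^-1 <= n%:R * x ^+ n.+1 * (a - b).
Proof.
move=> x0 xb ba.
have b0 : 0 < b by rewrite -(pmulr_rgt0 _ x0); lra.
have a0 : 0 < a by lra.
have vx : b^-1 <= x by rewrite -[leLHS]mul1r ler_pdivrMr.
have vab : a^-1 <= b^-1 by rewrite lef_pV2// ?posrE.
rewrite -!exprVn; elim: n => [|n IH]; first by rewrite !expr0; lra.
have va0 : 0 < a^-1 by rewrite invr_gt0.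
have vb0 : 0 < b^-1 by rewrite invr_gt0.
have d1 : b^-1 - a^-1 = b^-1 * a^-1 * (a - b).
  by field; rewrite !gt_eqF.
have bn : b^-1 ^+ n <= x ^+ n by rewrite lerXn2r// nnegrE ltW.
have bn0 : 0 <= b^-1 ^+ n by rewrite exprn_ge0// ltW.
have -> : b^-1 ^+ n.+1 - a^-1 ^+ n.+1 =
  (b^-1 ^+ n - a^-1 ^+ n) * a^-1 + b^-1 ^+ n * (b^-1 - a^-1).
  by rewrite !exprSr; ring.
have -> : n.+1%:R * x ^+ n.+2 * (a - b) =
  (n%:R * x ^+ n.+1 * (a - b)) * x + x ^+ n * (x * x * (a - b)).
  by rewrite -natr1 !exprSr; ring.
apply: lerD.
  apply: ler_pM => //; last exact: le_trans vx.
    by rewrite subr_ge0 lerXn2r// nnegrE ltW.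
  exact: ltW.
rewrite d1; apply: ler_pM => //; first by rewrite !mulr_ge0 ?subr_ge0// ltW.
apply: ler_wpM2r; first by rewrite subr_ge0.
by apply: ler_pM => //; [exact: ltW|exact: ltW|exact: le_trans vx].
Qed.

Lemma spread_tail x a b i : 0 < x -> x * b >= 1 -> b <= a ->
  `|a ^+ (0 + 4) / a ^+ (4 + i) - b ^+ (0 + 4) / b ^+ (4 + i)|
    <= i%:R * x ^+ i.+1 * (a - b).
Proof.
move=> x0 xb ba.
have b0 : 0 < b by rewrite -(pmulr_rgt0 _ x0); lra.
have a0 : 0 < a by lra.
have E (y : R) : 0 < y -> y ^+ (0 + 4) / y ^+ (4 + i) = (y ^+ i)^-1.
  move=> y0; rewrite add0n exprD invfM mulrA divff ?mul1r//.
  by rewrite expf_neq0// gt_eqF.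
rewrite !E// distrC ger0_norm; first exact: exprV_lip.
by rewrite subr_ge0 lef_pV2 ?posrE ?exprn_gt0// lerXn2r// nnegrE ltW.
Qed.

(** The sum of i x^(i+1) over the exponents of the blocks has the closed form
(al * i + ga) x^i for suitable al and ga; the two inequalities say that the
given constants are at least the solution, so no limit is needed. *)
Lemma spread_tail_blocks D (x al ga : R) i N a b : 0 < x -> x * b >= 1 -> b <= a ->
  0 <= al -> 0 <= ga ->
  x + x ^+ 2 + al * x ^+ D <= al -> x ^+ 2 + (al * D%:R + ga) * x ^+ D <= ga ->
  spread 0 (gap_blocks D (4 + i) N) a b <= (al * i%:R + ga) * x ^+ i * (a - b).
Proof.
move=> x0 xb ba al0 ga0 hal hga.
elim: N i => [|N IH] i.
  rewrite /= /spread big_nil !mulr_ge0 ?subr_ge0 ?exprn_ge0 ?(ltW x0)//.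
  by rewrite addr_ge0// mulr_ge0.
rewrite /= !spread_cons -addnS -addnA.
have h1 := @spread_tail x a b i x0 xb ba.
have h2 := @spread_tail x a b i.+1 x0 xb ba.
have h3 := IH (i + D)%N.
apply: le_trans (lerD h1 (lerD h2 h3)) _.
rewrite -!mulrDl; apply: ler_wpM2r; first by rewrite subr_ge0.
have -> : i%:R * x ^+ i.+1 +
  (i.+1%:R * x ^+ i.+2 + (al * (i + D)%:R + ga) * x ^+ (i + D)) =
  (i%:R * (x + x ^+ 2 + al * x ^+ D) + (x ^+ 2 + (al * D%:R + ga) * x ^+ D))
   * x ^+ i.
  by rewrite natrD -natr1 exprD !exprS; ring.
apply: ler_wpM2r; first by rewrite exprn_ge0// ltW.
by rewrite [al * i%:R]mulrC; apply: lerD => //; apply: ler_wpM2l.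
Qed.

End expanding.

Section numeric.
Context {R : realFieldType}.
Implicit Types (a b x : R).

Lemma spread_head a b i j : 0 < b -> b <= a ->
  `|a ^+ (i + j) / a ^+ i - b ^+ (i + j) / b ^+ i| = a ^+ j - b ^+ j.
Proof.
move=> b0 ba; have a0 : 0 < a by lra.
have E (y : R) : 0 < y -> y ^+ (i + j) / y ^+ i = y ^+ j.
  by move=> y0; rewrite exprD mulrC mulKf// expf_neq0// gt_eqF.
by rewrite !E// ger0_norm// subr_ge0 lerXn2r// nnegrE; lra.
Qed.

(** The transversality condition, in finite differences: a sum with first nonzero
term a^-k has, once multiplied by a^(k+4), slope at least 1/4 in the base. The
first nonzero term is either the first or the second one of a block, whence the
two inequalities. *)
Definition expanding_from (D : nat) (lo : R) := forall k N a b,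
  lo <= b -> b <= a ->
  (a - b) / 4 <= a ^+ 4 - b ^+ 4
    - spread k (k.+1 :: gap_blocks D (k + D) N) a b /\
  (a - b) / 4 <= a ^+ 4 - b ^+ 4 - spread k.+1 (gap_blocks D (k + D) N) a b.

Lemma subr_exp4 a b : a ^+ 4 - b ^+ 4 =
  (a - b) * (a ^+ 3 + a ^+ 2 * b + a * b ^+ 2 + b ^+ 3).
Proof. by ring. Qed.

Lemma subr_exp3 a b : a ^+ 3 - b ^+ 3 = (a - b) * (a ^+ 2 + a * b + b ^+ 2).
Proof. by ring. Qed.

Lemma subr_exp2 a b : a ^+ 2 - b ^+ 2 = (a - b) * (a + b).
Proof. by ring. Qed.

(** The polynomials bounded from below here and in the next two lemmas are the
divided differences of a^4 minus those of the powers a^3, a^2, a that the pattern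
contains. They increase with a and b, so the bound is the value at the left end
point, rounded down. *)
Lemma sparse_slope_ge_fst a b : 141 / 100 <= b -> b <= a ->
  424 / 100 <= (a ^+ 3 + a ^+ 2 * b + a * b ^+ 2 + b ^+ 3)
    - (a ^+ 2 + a * b + b ^+ 2) - 1.
Proof.
move=> hb ba.
have [u u0 bE] : exists2 u, 0 <= u & b = 141 / 100 + u by exists (b - 141 / 100); lra.
have [v v1 aE] : exists2 v, 0 <= v & a = 141 / 100 + v by exists (a - 141 / 100); lra.
rewrite aE bE.
by have := mulr_ge0 u0 v1; have := mulr_ge0 u0 u0; have := mulr_ge0 v1 v1;
   nra.
Qed.

Lemma full_slope_ge a b : 157 / 100 <= b -> b <= a ->
  394 / 100 <= (a ^+ 3 + a ^+ 2 * b + a * b ^+ 2 + b ^+ 3)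
    - (a ^+ 2 + a * b + b ^+ 2) - (a + b) - 1.
Proof.
move=> hb ba.
have [u u0 bE] : exists2 u, 0 <= u & b = 157 / 100 + u by exists (b - 157 / 100); lra.
have [v v1 aE] : exists2 v, 0 <= v & a = 157 / 100 + v by exists (a - 157 / 100); lra.
rewrite aE bE.
by have := mulr_ge0 u0 v1; have := mulr_ge0 u0 u0; have := mulr_ge0 v1 v1;
   nra.
Qed.

Lemma sparse_slope_ge_snd a b : 141 / 100 <= b -> b <= a ->
  6 <= (a ^+ 3 + a ^+ 2 * b + a * b ^+ 2 + b ^+ 3) - (a + b) - 1.
Proof.
move=> hb ba.
have [u u0 bE] : exists2 u, 0 <= u & b = 141 / 100 + u by exists (b - 141 / 100); lra.
have [v v1 aE] : exists2 v, 0 <= v & a = 141 / 100 + v by exists (a - 141 / 100); lra.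
rewrite aE bE.
by have := mulr_ge0 u0 v1; have := mulr_ge0 u0 u0; have := mulr_ge0 v1 v1;
   nra.
Qed.

Lemma spread_head3 a b : 0 < b -> b <= a ->
  `|a ^+ (0 + 4) / a ^+ 3 - b ^+ (0 + 4) / b ^+ 3| = a - b.
Proof. by move=> b0 ba; rewrite (spread_head a b 3 1). Qed.

Lemma spread_head4 a b : 0 < b -> b <= a ->
  `|a ^+ (0 + 4) / a ^+ 4 - b ^+ (0 + 4) / b ^+ 4| = 0.
Proof. by move=> b0 ba; rewrite (spread_head a b 4 0)// subrr. Qed.

Lemma spread_head2 a b : 0 < b -> b <= a ->
  `|a ^+ (0 + 4) / a ^+ 2 - b ^+ (0 + 4) / b ^+ 2| = a ^+ 2 - b ^+ 2.
Proof. by move=> b0 ba; rewrite (spread_head a b 2 2). Qed.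

Lemma spread_head1 a b : 0 < b -> b <= a ->
  `|a ^+ (0 + 4) / a ^+ 1 - b ^+ (0 + 4) / b ^+ 1| = a ^+ 3 - b ^+ 3.
Proof. by move=> b0 ba; rewrite (spread_head a b 1 3). Qed.

Lemma spread_head_first a b k : 0 < b -> b <= a ->
  `|a ^+ (k + 4) / a ^+ k.+1 - b ^+ (k + 4) / b ^+ k.+1| = a ^+ 3 - b ^+ 3.
Proof.
move=> b0 ba; have -> : (k + 4 = k.+1 + 3)%N by lia.
by rewrite spread_head.
Qed.

(** At the base sqrt 2 the margin is about one half, so it is still positive at
1.41 with rounded constants. *)
Lemma expanding_from3 : expanding_from 3 (141 / 100).
Proof.
move=> k N a b hb ba; have b0 : 0 < b by lra.
have a0 : 0 < a by lra.
(* 1.9 and 3.96 solve the tail recursion at x = 1/1.41 up to rounding. *)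
have tail i n : spread 0 (gap_blocks 3 (4 + i) n) a b <= _ :=
  @spread_tail_blocks R 3 (100 / 141) (19 / 10) (396 / 100) i n a b
    ltac:(lra) ltac:(lra) ba ltac:(lra) ltac:(lra) ltac:(lra) ltac:(lra).
have m2 t : spread 0 (gap_blocks 3 t N) a b <= spread 0 (gap_blocks 3 t N.+2) a b.
  exact: le_trans (spread_mono _ _ _ _ _) (spread_mono _ _ _ _ _).
have ab0 : 0 <= a - b by rewrite subr_ge0.
split.
  rewrite spread_cons spread_head_first// spread_shift//.
  have := m2 3%N; rewrite gap_blocksS 2!spread_cons spread_head3// spread_head4//.
  have : spread 0 (gap_blocks 3 (3 + 3) N.+1) a b <= _ := tail 2%N N.+1.
  have := ler_wpM2l ab0 (sparse_slope_ge_fst _ _ hb ba).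
  rewrite subr_exp4 subr_exp3.
  lra.
rewrite (_ : k + 3 = k.+1 + 2)%N; last by lia.
rewrite spread_shift//.
have := m2 2%N; rewrite gap_blocksS 2!spread_cons spread_head2// spread_head3//.
have : spread 0 (gap_blocks 3 (2 + 3) N.+1) a b <= _ := tail 1%N N.+1.
have := ler_wpM2l ab0 (sparse_slope_ge_snd _ _ hb ba).
rewrite subr_exp4 subr_exp2.
lra.
Qed.

Lemma expanding_from2 : expanding_from 2 (157 / 100).
Proof.
move=> k N a b hb ba; have b0 : 0 < b by lra.
have a0 : 0 < a by lra.
(* 1.8 and 3.16 solve the tail recursion at x = 1/1.57 up to rounding. *)
have tail i n : spread 0 (gap_blocks 2 (4 + i) n) a b <= _ :=
  @spread_tail_blocks R 2 (100 / 157) (18 / 10) (316 / 100) i n a b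
    ltac:(lra) ltac:(lra) ba ltac:(lra) ltac:(lra) ltac:(lra) ltac:(lra).
have m2 t : spread 0 (gap_blocks 2 t N) a b <= spread 0 (gap_blocks 2 t N.+2) a b.
  exact: le_trans (spread_mono _ _ _ _ _) (spread_mono _ _ _ _ _).
have ab0 : 0 <= a - b by rewrite subr_ge0.
split.
  rewrite spread_cons spread_head_first// spread_shift//.
  have := m2 2%N; rewrite 2!gap_blocksS 4!spread_cons spread_head2// spread_head3//.
  rewrite spread_head4//.
  have := @spread_tail R (100 / 157) a b 1 ltac:(lra) ltac:(lra) ba.
  rewrite (_ : 4 + 1 = (2 + 2).+1)%N// => t1.
  have : spread 0 (gap_blocks 2 (2 + 2 + 2) N) a b <= _ := tail 2%N N.
  have := ler_wpM2l ab0 (full_slope_ge _ _ hb ba).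
  rewrite subr_exp4 subr_exp3 subr_exp2; move: t1.
  lra.
rewrite (_ : k + 2 = k.+1 + 1)%N; last by lia.
rewrite spread_shift//.
have := m2 1%N; rewrite 2!gap_blocksS 4!spread_cons spread_head1// spread_head2//.
rewrite spread_head3// spread_head4//.
have : spread 0 (gap_blocks 2 (1 + 2 + 2) N) a b <= _ := tail 1%N N.
have := ler_wpM2l ab0 (full_slope_ge _ _ hb ba).
rewrite subr_exp4 subr_exp3 subr_exp2.
lra.
Qed.

End numeric.

(** * Integrating the collision probability over the base *)
Section walk.
Context {R : realType}.
Implicit Types (rho z s : R) (l : seq R).

(** The probability that |z + S| <= rho, where S is a sum of independent steps,
the one attached to s being 0 with probability 1/2 and s or -s with probability
1/4 each: the difference of two independent fair coins, times s. *)
Fixpoint walk rho l z : R :=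
  if l is s :: l' then
    walk rho l' z / 2 + (walk rho l' (z + s) + walk rho l' (z - s)) / 4
  else (`|z| <= rho)%R%:R.

Lemma walk_ge0 rho l z : 0 <= walk rho l z.
Proof.
elim: l z => [|s l IH] z /=; first by rewrite ler0n.
by have := IH z; have := IH (z + s); have := IH (z - s); lra.
Qed.

End walk.

Section transversality.
Context {R : realType}.
Notation mu := (@lebesgue_measure R).
Variables (p D : nat) (lo hi : R).
Implicit Types (q : R -> R) (rho : R) (l : seq nat).
Hypothesis p_gt0 : (0 < p)%N.
Hypothesis lo_exp : expanding_from D lo.
Hypothesis hi_gt1 : 1 < hi.
Hypothesis hiD : hi ^+ D < 4.

Let hi_ge0 : 0 <= hi.
Proof. exact: ltW (lt_trans ltr01 hi_gt1). Qed.

Definition window : set R := [set b | [/\ 1 < b, b < 2, lo <= b ^+ p & b ^+ p <= hi]].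

Lemma measurable_window : measurable window.
Proof.
have -> : window = [set` `]1, 2[] `&` (fun b => b ^+ p) @^-1` [set` `[lo, hi]].
  apply/seteqP; split => b /=.
    by case=> b1 b2 b3 b4; rewrite /= !in_itv/= b1 b2 b3 b4.
  by rewrite !in_itv/= => -[/andP[? ?] /andP[? ?]]; split.
have m : measurable_fun (`]1, 2[%classic : set R) (fun b : R => b ^+ p).
  by apply: measurable_funX.
by apply: m.
Qed.

Definition neg_power (k : nat) (b : R) : R := (b ^+ p) ^- k.

Lemma measurable_neg_power k : measurable_fun window (neg_power k).
Proof.
(* The maximum with 1 makes the function monotone on the whole line. *)
apply: (@eq_measurable_fun _ _ R R window (fun b : R => (Num.max b 1 ^+ p) ^- k)).
  move=> b; rewrite inE => -[b1 _ _ _].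
  by rewrite /neg_power max_l// ltW.
apply: nonincreasing_measurable; first exact: measurable_window.
move=> x y xy; have m1 (t : R) : 1 <= Num.max t 1 by rewrite le_max lexx orbT.
have m0 (t : R) : 0 < Num.max t 1 by rewrite (lt_le_trans _ (m1 t)).
rewrite lef_pV2 ?posrE ?exprn_gt0// lerXn2r ?nnegrE ?exprn_ge0 ?(ltW (m0 _))//.
rewrite lerXn2r ?nnegrE ?(ltW (m0 _))//.
by rewrite ge_max !le_max xy lexx orbT.
Qed.

Definition walk_at rho (l : seq nat) (q : R -> R) (b : R) : R :=
  walk rho [seq neg_power k b | k <- l] (q b).

Lemma measurable_walk_at rho l q : measurable_fun window q ->
  measurable_fun window (walk_at rho l q).
Proof.
elim: l q => [|k l IH] q mq.
  rewrite (_ : walk_at _ _ _ = fun b => (if `|q b| <= rho then 1 else 0)); last first.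
    by apply/funext => b; rewrite /walk_at/=; case: ifP.
  apply: measurable_fun_if => //; first exact: measurable_window.
  by apply: measurable_fun_ler => //; exact: measurableT_comp.
have mm := measurable_neg_power k.
rewrite (_ : walk_at _ _ _ = fun b => walk_at rho l q b / 2 +
  (walk_at rho l (q \+ neg_power k) b + walk_at rho l (q \- neg_power k) b) / 4) //.
by apply: measurable_funD; [|apply: measurable_funM => //; apply: measurable_funD];
  [apply: measurable_funM => //; exact: IH|apply: IH; exact: measurable_funD|
   apply: IH; exact: measurable_funB].
Qed.

Definition walk_mass rho l q : \bar R :=
  (\int[mu]_(b in window) (walk_at rho l q b)%:E)%E.

Lemma walk_mass_cons rho k l q : measurable_fun window q ->
  walk_mass rho (k :: l) q = (2^-1%:E * walk_mass rho l q +
    4^-1%:E * (walk_mass rho l (q \+ neg_power k)%R +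
      walk_mass rho l (q \- neg_power k)%R))%E.
Proof.
move=> mq; have mw := measurable_window; have mm := measurable_neg_power k.
have m1 := measurable_walk_at rho l _ mq.
have m2 := measurable_walk_at rho l _ (measurable_funD mq mm).
have m3 := measurable_walk_at rho l _ (measurable_funB mq mm).
have w0 f b : (0 <= (walk_at rho l f b)%:E)%E by rewrite lee_fin walk_ge0.
rewrite /walk_mass -ge0_integralD//; try exact/measurable_EFinP.
rewrite -!ge0_integralZl_EFin//; try exact/measurable_EFinP.
- rewrite -ge0_integralD//.
  + apply: eq_integral => b _; congr (_%:E).
    by rewrite /walk_at/= mulrC [_ / 4]mulrC.
  + by move=> b _; rewrite mule_ge0// lee_fin.
  + by apply: measurable_funeM; exact/measurable_EFinP.
  + by move=> b _; apply: mule_ge0; [rewrite lee_fin|exact: adde_ge0].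
  + apply: measurable_funeM; apply: emeasurable_funD; exact/measurable_EFinP.
- by move=> b _; rewrite adde_ge0.
- by apply: emeasurable_funD; exact/measurable_EFinP.
Qed.

(** Whatever steps from l are still taken, the normalised sum keeps slope at
least 1/4 in b^p: the condition is stable under taking or skipping the head of
l, which is how the walk consumes it. *)
Definition repelled k (q : R -> R) l := forall b1 b2, window b1 -> window b2 ->
  b2 <= b1 ->
  (b1 ^+ p - b2 ^+ p) / 4 + spread k l (b1 ^+ p) (b2 ^+ p) <=
    `| (b1 ^+ p) ^+ (k + 4) * q b1 - (b2 ^+ p) ^+ (k + 4) * q b2|.

Lemma repelled_tail k q i l : repelled k q (i :: l) -> repelled k q l.
Proof.
move=> h b1 b2 w1 w2 b21; apply: le_trans (h _ _ w1 w2 b21).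
by rewrite lerD2l spread_cons lerDr.
Qed.

Lemma repelled_add k q i l : repelled k q (i :: l) -> repelled k (q \+ neg_power i) l.
Proof.
move=> h b1 b2 w1 w2 b21; have := h _ _ w1 w2 b21.
rewrite spread_cons /= /neg_power !mulrDr.
set u := _ * q b1; set v := _ * q b2; set s := _ / _ ^+ i; set t := _ / _ ^+ i.
have -> : u + s - (v + t) = (u - v) + (s - t) by ring.
have := ler_normD (u - v + (s - t)) (t - s).
rewrite (distrC t s) (_ : u - v + (s - t) + (t - s) = u - v); first lra.
by ring.
Qed.

Lemma repelled_sub k q i l : repelled k q (i :: l) -> repelled k (q \- neg_power i) l.
Proof.
move=> h b1 b2 w1 w2 b21; have := h _ _ w1 w2 b21.
rewrite spread_cons /= /neg_power !mulrBr.
set u := _ * q b1; set v := _ * q b2; set s := _ / _ ^+ i; set t := _ / _ ^+ i.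
have -> : u - s - (v - t) = (u - v) - (s - t) by ring.
have := ler_normD (u - v - (s - t)) (s - t).
rewrite (_ : u - v - (s - t) + (s - t) = u - v); first lra.
by ring.
Qed.

Lemma window_lip b1 b2 : window b1 -> window b2 -> b2 <= b1 ->
  b1 - b2 <= b1 ^+ p - b2 ^+ p.
Proof.
case: p p_gt0 => // n _ [g1 _ _ _] [g2 _ _ _] b21.
elim: n => [|n IH]; first by rewrite !expr1.
rewrite exprS [b2 ^+ n.+2]exprS.
have e2 : 1 <= b2 ^+ n.+1 by rewrite exprn_ege1// ltW.
have e1 : 1 <= b1 ^+ n.+1 by rewrite exprn_ege1// ltW.
nra.
Qed.

(** If |q| <= rho at two bases, then the normalised sums differ there by at most
2 hi^(k+4) rho; the slope 1/4 in b^p, and the slope at least 1 of b^p in b, put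
the two bases within 8 hi^(k+4) rho of each other. *)
Lemma walk_mass_nil k q rho : 0 <= rho -> measurable_fun window q ->
  repelled k q [::] -> (walk_mass rho [::] q <= (16 * hi ^+ (k + 4) * rho)%:E)%E.
Proof.
move=> rho0 mq hq; have mw := measurable_window.
have [[x0 [x0w x0q]]|nex] := pselect (exists x, window x /\ `|q x| <= rho).
  have h0 : 0 <= hi ^+ (k + 4) by rewrite exprn_ge0.
  set d := 8 * hi ^+ (k + 4) * rho.
  have d0 : 0 <= d by rewrite !mulr_ge0.
  have close b c : window b -> window c -> c <= b -> `|q b| <= rho -> `|q c| <= rho ->
      b - c <= d.
    move=> wb wc cb qb qc; have := hq b c wb wc cb.
    rewrite /spread big_nil addr0 => e.
    have lip := window_lip _ _ wb wc cb.
    have bd x : window x -> `|q x| <= rho ->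
        `|(x ^+ p) ^+ (k + 4) * q x| <= hi ^+ (k + 4) * rho.
      move=> [x1 _ _ xh] qx; rewrite normrM ger0_norm; last first.
        by rewrite !exprn_ge0//; lra.
      apply: ler_pM => //; first by rewrite !exprn_ge0//; lra.
      by rewrite lerXn2r// nnegrE ?exprn_ge0//; lra.
    have := ler_normB ((b ^+ p) ^+ (k + 4) * q b) ((c ^+ p) ^+ (k + 4) * q c).
    have := bd _ wb qb; have := bd _ wc qc; rewrite /d; lra.
  apply: (@le_trans _ _ (\int[mu]_(b in window) (\1_(`[x0 - d, x0 + d]%classic) b)%:E)%E).
    apply: ge0_le_integral => //.
    - by move=> b _; rewrite lee_fin walk_ge0.
    - by apply/measurable_EFinP; exact: measurable_walk_at.
    - by apply/measurable_EFinP; exact: measurable_indic.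
    - move=> b wb; rewrite lee_fin /walk_at/=; case: (boolP (`|q b| <= rho)) => // qb.
      rewrite indicE mem_set//= in_itv/=; apply/andP.
      by case: (lerP x0 b) => bx; [have := close _ _ wb x0w bx qb x0q|
        have := close _ _ x0w wb (ltW bx) x0q qb]; split; lra.
  rewrite integral_indic//.
  apply: (@le_trans _ _ (mu `[x0 - d, x0 + d]%classic)).
    by rewrite le_measure ?inE//; exact: measurableI.
  rewrite lebesgue_measure_itv/=; case: ifPn => _; rewrite -?EFinB lee_fin.
    by rewrite /d; lra.
  by move: d0; rewrite /d; lra.
rewrite /walk_mass (@eq_integral _ _ _ _ _ (cst 0%E)); last first.
  move=> b; rewrite inE => wb; rewrite /walk_at/=; case: (boolP (`|q b| <= rho)) => // qb.
  by exfalso; apply: nex; exists b.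
by rewrite integral0 lee_fin !mulr_ge0// exprn_ge0//; lra.
Qed.

Lemma walk_mass_le k l q rho : 0 <= rho -> measurable_fun window q ->
  repelled k q l -> (walk_mass rho l q <= (16 * hi ^+ (k + 4) * rho)%:E)%E.
Proof.
move=> rho0; elim: l q => [|i l IH] q mq hq; first exact: walk_mass_nil.
have mm := measurable_neg_power i.
have h1 := IH _ mq (repelled_tail _ _ _ _ hq).
have h2 := IH _ (measurable_funD mq mm) (repelled_add _ _ _ _ hq).
have h3 := IH _ (measurable_funB mq mm) (repelled_sub _ _ _ _ hq).
rewrite walk_mass_cons//; set B := 16 * _ * _ in h1 h2 h3 *.
have -> : B%:E = (2^-1%:E * B%:E + 4^-1%:E * (B%:E + B%:E))%E.
  by congr (_%:E); field.
by apply: leeD; apply: lee_wpmul2l; rewrite ?lee_fin//; exact: leeD.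
Qed.

Lemma repelled_start k l : (forall a b, lo <= b -> b <= a ->
    (a - b) / 4 <= a ^+ 4 - b ^+ 4 - spread k l a b) ->
  repelled k (cst 0 \+ neg_power k) l /\ repelled k (cst 0 \- neg_power k) l.
Proof.
move=> h; have E (b : R) : window b -> (b ^+ p) ^+ (k + 4) * neg_power k b = (b ^+ p) ^+ 4.
  case=> b1 _ _ _; rewrite /neg_power exprD mulrAC divff ?mul1r// !expf_neq0// gt_eqF//; lra.
have le x1 x2 : window x1 -> window x2 -> x2 <= x1 ->
    (x1 ^+ p - x2 ^+ p) / 4 + spread k l (x1 ^+ p) (x2 ^+ p) <=
    `|(x1 ^+ p) ^+ 4 - (x2 ^+ p) ^+ 4|.
  move=> w1 w2 x21; have := h (x1 ^+ p) (x2 ^+ p) _ _.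
  have [? _ ? _] := w2; have [? _ _ _] := w1.
  move=> /(_ ltac:(done)) /(_ ltac:(by rewrite lerXn2r// nnegrE; lra)) => ?.
  by apply: le_trans (ler_norm _); lra.
split=> b1 b2 w1 w2 b21 /=; first by rewrite !add0r !E//; exact: le.
by rewrite !sub0r !mulrN !E// -opprD normrN; exact: le.
Qed.

(** At each exponent k the walk rests with probability 1/2; otherwise its first
nonzero step is there, and transversality bounds what follows by a multiple of
rho hi^k. A block has two exponents, hence the factor 1/4 against the growth
hi^D of the bound, and the geometric series converges because hi^D < 4. *)
Lemma walk_mass_gap_blocks N k rho : 0 <= rho ->
  (walk_mass rho (gap_blocks D k N) (cst 0%R) <=
   ((4 * hi ^+ 5 + 8 * hi ^+ 4) / (1 - hi ^+ D / 4) * rho * hi ^+ k + 4 ^- N)%:E)%E.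
Proof.
move=> rho0; set A := _ / _.
have A0 : 0 <= A.
  by apply: divr_ge0; [rewrite addr_ge0// mulr_ge0// exprn_ge0|
    rewrite subr_ge0 ler_pdivrMr// mul1r ltW].
have mw := measurable_window.
have hi0 := hi_ge0.
elim: N k => [|N IH] k.
  apply: (@le_trans _ _ 1%E).
    apply: (@le_trans _ _ (\int[mu]_(b in window) (cst 1 b))%E).
      apply: ge0_le_integral => //.
      - by move=> b _; rewrite lee_fin walk_ge0.
      - by apply/measurable_EFinP; exact: measurable_walk_at.
      - by move=> b _; rewrite lee_fin /walk_at/=; case: (`|_| <= _).
    rewrite integral_cst// mul1e.
    apply: (@le_trans _ _ (mu `]1, 2[%classic)).
      by apply: le_measure; rewrite ?inE// => b [b1 b2 _ _]; rewrite /= in_itv/= b1.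
    by rewrite lebesgue_measure_itv/=; case: ifP => _; rewrite -?EFinB lee_fin; lra.
  rewrite lee_fin expr0 invr1 lerDr.
  by apply: mulr_ge0; [exact: mulr_ge0|exact: exprn_ge0].
have start k' l : (forall a b, lo <= b -> b <= a ->
    (a - b) / 4 <= a ^+ 4 - b ^+ 4 - spread k' l a b) ->
    (walk_mass rho (k' :: l) (cst 0%R) <=
     2^-1%:E * walk_mass rho l (cst 0%R) + (8 * hi ^+ (k' + 4) * rho)%:E)%E.
  move=> /repelled_start[r1 r2]; rewrite walk_mass_cons//; apply: leeD => //.
  have mm := measurable_neg_power k'.
  have -> : (8 * hi ^+ (k' + 4) * rho)%:E = (4^-1%:E *
    ((16 * hi ^+ (k' + 4) * rho)%:E + (16 * hi ^+ (k' + 4) * rho)%:E))%E.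
    by congr (_%:E); field.
  apply: lee_wpmul2l; first by rewrite lee_fin.
  by apply: leeD; apply: walk_mass_le => //; [exact: measurable_funD|exact: measurable_funB].
apply: le_trans (start _ _ _) _; first by move=> a b hb hab; have [] := lo_exp k N a b hb hab.
have := start k.+1 (gap_blocks D (k + D) N).
move=> /(_ _)/le_trans/(_ (leeD (lee_wpmul2l _ (IH (k + D)%N)) (lexx _))).
have -> : ((A * rho * hi ^+ k + 4 ^- N.+1)%:E =
  2^-1%:E * (2^-1%:E * (A * rho * hi ^+ (k + D) + 4 ^- N)%:E +
    (8 * hi ^+ (k.+1 + 4) * rho)%:E) + (8 * hi ^+ (k + 4) * rho)%:E)%E.
  congr (_%:E).
  have AE : A * (1 - hi ^+ D / 4) = 4 * hi ^+ 5 + 8 * hi ^+ 4.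
    by rewrite /A -mulrA mulVf ?mulr1// gt_eqF// subr_gt0 ltr_pdivrMr// mul1r.
  have A2 : A = A * (1 - hi ^+ D / 4) + A * hi ^+ D / 4 by ring.
  rewrite [in LHS]A2 AE !exprD !exprS expr0 invfM.
  by field.
move=> h; apply: leeD => //; apply: lee_wpmul2l; first by rewrite lee_fin.
apply: h; first by move=> a b hb hab; have [] := lo_exp k N a b hb hab.
by rewrite lee_fin.
Qed.

End transversality.

(** * Almost every base has bounded collision energy along a sequence of scales *)
Section frequently.
Context {R : realType}.
Notation mu := (@lebesgue_measure R).

(** Fatou: the lower limit of the u m has a finite integral, so it is finite
almost everywhere, and a finite lower limit is approached infinitely often. *)
Lemma ae_frequently_bounded (J : set R) (u : nat -> R -> R) (C : R) :
  measurable J -> (forall m, measurable_fun J (u m)) ->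
  (forall m b, 0 <= u m b) ->
  (forall m, (\int[mu]_(b in J) (u m b)%:E <= C%:E)%E) ->
  {ae mu, forall b, J b ->
    exists K, forall m0, exists2 m, (m0 <= m)%N & u m b <= K}.
Proof.
move=> mJ m_u u0 uC.
pose h b := limn_einf (fun m => (u m b)%:E).
have mh : measurable_fun J h.
  rewrite /h /limn_einf; apply: measurableT_comp => //.
  apply: measurable_fun_limn_esup => m.
  by apply: measurableT_comp => //; exact/measurable_EFinP.
have h0 b : (0 <= h b)%E.
  rewrite /h limn_einf_lim; apply: lime_ge; first exact: is_cvg_einfs.
  by apply: nearW => n; apply: le_ereal_inf_tmp => _ [m _ <-]; rewrite lee_fin.
have hC : (\int[mu]_(b in J) h b <= C%:E)%E.
  apply: (le_trans (@fatou _ _ _ mu _ mJ (fun m b => (u m b)%:E) _ _)).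
  - by move=> m; apply/measurable_EFinP; exact: m_u.
  - by move=> m b _; rewrite lee_fin.
  rewrite limn_einf_lim; apply: lime_le; first exact: is_cvg_einfs.
  apply: nearW => n; apply: le_trans (uC n).
  by apply: ereal_inf_lbound; exists n; rewrite /= ?leqnn.
have ih : mu.-integrable J h.
  apply/integrableP; split => //; apply: le_lt_trans (ltry C).
  by under eq_integral do rewrite gee0_abs//.
move: (@integrable_ae _ _ _ mu J mJ h ih); apply: filterS.
move=> b hb Jb.
have := hb Jb; rewrite ge0_fin_numE// => hlt.
apply: contrapT => nK; suff : h b = +oo%E by move=> e; rewrite e ltxx in hlt.
apply/eqyP => K K0; have /existsNP[m0 nm0] :
    ~ forall m0, exists2 m, (m0 <= m)%N & u m b <= K.
  by move=> hK; apply: nK; exists K.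
rewrite /h limn_einf_lim; apply: lime_ge; first exact: is_cvg_einfs.
near=> n; apply: le_ereal_inf_tmp => _ [m /= nm <-]; rewrite lee_fin leNgt.
apply/negP => umK; apply: nm0; exists m; last exact: ltW.
by apply: leq_trans nm; near: n; exists m0.
Unshelve. all: by end_near. Qed.

(** The collision probability at scale 2^-m divided by that scale; up to a
constant factor it dominates the squared L2 norm of the difference quotients of
the Bernoulli convolution over that length. *)
Definition energy (p D m : nat) (b : R) : R :=
  2 ^+ m * walk_at p (2 * 2 ^- m) (gap_blocks D 1 m) (cst 0) b.

Lemma energy_window p D lo hi : (0 < p)%N -> expanding_from D lo -> 1 < hi ->
  hi ^+ D < 4 ->
  {ae mu, forall b, window p lo hi b ->
    exists K, forall m0, exists2 m, (m0 <= m)%N & energy p D m b <= K}.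
Proof.
move=> p0 lo_exp hi1 hiD; have mw := measurable_window p lo hi.
set A := (4 * hi ^+ 5 + 8 * hi ^+ 4) / (1 - hi ^+ D / 4).
apply: (@ae_frequently_bounded _ _ (2 * A * hi + 1)) => //.
- move=> m; apply: measurable_funM => //; exact: measurable_walk_at.
- by move=> m b; rewrite mulr_ge0 ?exprn_ge0// walk_ge0.
move=> m; rewrite /energy; under eq_integral do rewrite EFinM.
rewrite ge0_integralZl_EFin//; last 2 first.
- by move=> b _; rewrite lee_fin walk_ge0.
- by apply/measurable_EFinP; exact: measurable_walk_at.
- have r0 : (0 : R) <= 2 * 2 ^- m by rewrite mulr_ge0// invr_ge0 exprn_ge0.
  have := walk_mass_gap_blocks _ _ _ _ p0 lo_exp hi1 hiD m 1 _ r0.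
  rewrite -/A /walk_mass => tot.
  apply: (le_trans (lee_wpmul2l _ tot)); first by rewrite lee_fin exprn_ge0.
  rewrite -EFinM lee_fin mulrDr; apply: lerD.
    have -> : 2 ^+ m * (A * (2 * 2 ^- m) * hi ^+ 1) = 2 * A * hi * (2 ^+ m / 2 ^+ m).
      by rewrite expr1; ring.
    by rewrite divff ?mulr1// expf_neq0.
  have -> : 4 ^- m = (2 ^- m * 2 ^- m) :> R by rewrite -invfM -exprMn -natrM.
  by rewrite mulrA divff ?mul1r ?expf_neq0// invf_le1 ?exprn_gt0// exprn_ege1// ler1n.
Qed.

(** The last of the iterated squares of b that is below 2 is at least sqrt 2,
since its own square is not below 2. *)
Lemma power_in_window (b : R) : 1 < b -> b < 2 ->
  exists2 p, (0 < p)%N & b ^+ p < 2 /\ 141 / 100 <= b ^+ p.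
Proof.
move=> b1 b2.
have ex : exists n, 2 <= b ^+ (2 ^ n).
  have [N hN] : exists N, 2 <= b ^+ N.
    pose N := Num.bound (b - 1)^-1; exists N.
    have b10 : 0 < b - 1 by lra.
    have hN : (b - 1)^-1 < N%:R by rewrite archi_boundP// invr_ge0 ltW.
    have bern k : 1 + k%:R * (b - 1) <= b ^+ k.
      elim: k => [|k IH]; first by rewrite expr0 mul0r addr0.
      rewrite exprS -natr1; have k0 : (0 : R) <= k%:R by [].
      have := mulr_ge0 k0 (sqr_ge0 (b - 1)).
      move: IH => {}/(ler_wpM2l (ltW (lt_trans ltr01 b1))).
      move: (b ^+ k) (k%:R : R) => t s; nra.
    apply: le_trans (bern N); rewrite -lerBlDl (_ : 2 - 1 = 1); last by lra.
    by rewrite -ler_pdivrMr// mul1r ltW.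
  exists N; apply: (le_trans hN); apply: ler_weXn2l; first exact: ltW.
  by rewrite ltnW// ltn_expl.
case: (ex_minnP ex) => -[|m] hm mmin; first by move: hm; rewrite expr1; lra.
have lt2 : b ^+ (2 ^ m) < 2.
  by rewrite ltNge; apply/negP => /mmin; rewrite ltnn.
exists (2 ^ m)%N; [by rewrite expn_gt0|split => //].
move: hm; rewrite expnSr exprM; set t := b ^+ (2 ^ m).
have t0 : 0 < t by rewrite exprn_gt0//; lra.
by rewrite leNgt => /negP t2; rewrite leNgt; apply/negP => ?; apply: t2; nra.
Qed.

(** Powers of the base in [1.41, 1.58] are served by the sparse pattern, those
in [1.57, 2) by the full one; the upper end 2 is open, hence the countably many
windows ending at 2 - 1/(l+2). *)
Lemma ae_energy_bounded : {ae mu, forall b : R, 1 < b < 2 ->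
  exists p D, [/\ (0 < p)%N, (1 < D)%N & exists K, forall m0,
    exists2 m, (m0 <= m)%N & energy p D m b <= K]}.
Proof.
have /ae_foralln h3 p : {ae mu, forall b, window p.+1 (141 / 100) (158 / 100) b ->
    exists K, forall m0, exists2 m, (m0 <= m)%N & energy p.+1 3 m b <= K}.
  by apply: energy_window => //; [exact: expanding_from3|lra|lra].
have h2 p : {ae mu, forall b, forall l, window p.+1 (157 / 100) (2 - l.+2%:R^-1) b ->
    exists K, forall m0, exists2 m, (m0 <= m)%N & energy p.+1 2 m b <= K}.
  apply/ae_foralln => l; have l2 : l.+2%:R^-1 <= 2^-1 :> R.
    by rewrite lef_pV2 ?posrE// ler_nat.
  have l0 : 0 < l.+2%:R^-1 :> R by [].
  have [? ?] : 1 < 2 - l.+2%:R^-1 :> R /\ (2 - l.+2%:R^-1) ^+ 2 < 4 :> R.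
    by move: l2 l0; move: (l.+2%:R^-1 : R) => e ? ?; split; nra.
  by apply: energy_window => //; exact: expanding_from2.
have {}h2 := ae_foralln h2.
apply: filterS2 h3 h2 => b h3 h2 /andP[b1 b2].
have [[|p] // p0 [hp2 hp1]] := power_in_window _ b1 b2.
have [h|h] := leP (b ^+ p.+1) (158 / 100).
  by exists p.+1, 3%N; split => //; exact: h3.
exists p.+1, 2%N; split => //.
pose l := Num.bound (2 - b ^+ p.+1)^-1.
apply: (h2 p l); split => //; first lra.
have d0 : 0 < 2 - b ^+ p.+1 by lra.
have : (2 - b ^+ p.+1)^-1 < l%:R by rewrite archi_boundP// invr_ge0 ltW.
rewrite -[ltLHS]mul1r ltr_pdivrMr// => hl.
rewrite lerBrDr -lerBrDl -[leLHS]mul1r ler_pdivrMr//.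
apply/ltW/(lt_le_trans hl); rewrite mulrC ler_wpM2l//; first exact: ltW.
by rewrite ler_nat; lia.
Qed.

End frequently.

(** * Half steps and their autocorrelation *)
Section affine.
Context {R : realType}.
Notation mu := (@lebesgue_measure R).

Lemma measurable_affine (a b : R) : measurable_fun setT (fun x : R => a * x + b).
Proof. by apply: measurable_funD => //; apply: measurable_funM. Qed.

Lemma lebesgue_measure_affine (a b : R) (A : set R) : 0 < a -> measurable A ->
  mu ((fun x => a * x + b) @^-1` A) = (a^-1%:E * mu A)%E.
Proof.
move=> a0 mA.
have a_ge0 : 0 <= a by exact: ltW.
pose phi : measurableTypeR R -> measurableTypeR R := fun x => a * x + b.
have mphi : measurable_fun setT phi by exact: measurable_affine.
pose nu' := mscale (NngNum a_ge0) (pushforward mu phi); pose nu := nu' mphi.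
suff /(_ A mA) : forall A, measurable A -> mu A = nu A.
  move=> ->; rewrite /nu /nu' /mscale/= /pushforward muleA -EFinM mulVf ?mul1e//.
  by rewrite gt_eqF.
apply: lebesgue_measure_unique => X [[u v] _ <-] /=.
rewrite /nu /nu' /mscale/= /pushforward.
have -> : phi @^-1` `]u, v]%classic = `](u - b) / a, (v - b) / a]%classic.
  apply/seteqP; split => x /=; rewrite /phi !in_itv/= ltr_pdivrMr// ler_pdivlMr//;
    rewrite [x * a]mulrC => /andP[? ?]; apply/andP; split; lra.
rewrite !lebesgue_measure_itv/= !lte_fin ltr_pM2r ?invr_gt0// ltrD2r.
case: ifP => _; last by rewrite mule0.
by rewrite -!EFinB -EFinM; congr (_%:E); field; rewrite gt_eqF.
Qed.

Lemma integral_translate (g : R -> \bar R) (z : R) : measurable_fun setT g ->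
  (forall x, 0 <= g x)%E ->
  (\int[mu]_x g (x + z)%R = \int[mu]_x g x)%E.
Proof.
move=> mg g0.
pose phi : measurableTypeR R -> measurableTypeR R := fun x => 1 * x + z.
have mphi : measurable_fun setT phi by exact: measurable_affine.
have := @ge0_integral_pushforward _ _ _ _ R phi mphi mu setT g measurableT mg.
move=> /(_ (fun x _ => g0 x)); rewrite preimage_setT => e.
transitivity (\int[mu]_x (g \o phi) x)%E.
  by apply: eq_integral => x _; rewrite /= /phi mul1r.
rewrite -e; apply: eq_measure_integral => A mA _.
by have := lebesgue_measure_affine 1 z A ltr01 mA; rewrite invr1 mul1e.
Qed.

End affine.

Section steps.
Context {R : realType}.
Notation mu := (@lebesgue_measure R).
Implicit Types (f g : R -> R) (s r z x : R) (l : seq R).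

(** Convolution with a fair coin taking the values 0 and s. *)
Definition step s f x : R := (f x + f (x - s)) / 2.

Definition steps l f : R -> R := foldr step f l.

Definition nonneg_mfun f := measurable_fun setT f /\ forall x, 0 <= f x.

Lemma nonneg_mfun_shift f z : nonneg_mfun f -> nonneg_mfun (fun x => f (x + z)).
Proof.
move=> [mf f0]; split => //; apply: measurableT_comp => //.
exact: measurable_funD.
Qed.

Lemma nonneg_mfun_step s f : nonneg_mfun f -> nonneg_mfun (step s f).
Proof.
move=> nf; have [mf f0] := nf; have [mfs fs0] := nonneg_mfun_shift _ (- s) nf; split.
  by apply: measurable_funM => //; exact: measurable_funD.
by move=> x; rewrite /step; have := f0 x; have := f0 (x - s); lra.
Qed.

Lemma nonneg_mfun_steps l f : nonneg_mfun f -> nonneg_mfun (steps l f).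
Proof. by move=> nf; elim: l => //= s l IH; exact: nonneg_mfun_step. Qed.

(** The value at 0 is the squared L2 norm. *)
Definition autocorr f z : \bar R := (\int[mu]_x (f x * f (x + z))%:E)%E.

Lemma nonneg_mfun_autocorr f z : nonneg_mfun f ->
  measurable_fun setT (fun x => (f x * f (x + z))%:E) /\
  forall x, (0 <= (f x * f (x + z))%:E)%E.
Proof.
move=> nf; have [mf f0] := nf; have [mfs fs0] := nonneg_mfun_shift _ z nf; split.
  by apply/measurable_EFinP; exact: measurable_funM.
by move=> x; rewrite lee_fin mulr_ge0.
Qed.

(** Of the four products of translates of f, two are translates of the product
with unchanged lag and the other two have lag changed by s and -s. *)
Lemma autocorr_step s f z : nonneg_mfun f ->
  autocorr (step s f) z = (2^-1%:E * autocorr f z +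
    4^-1%:E * (autocorr f (z + s)%R + autocorr f (z - s)%R))%E.
Proof.
move=> nf; have [m1 p1] := nonneg_mfun_autocorr _ z nf.
have [m2 p2] := nonneg_mfun_autocorr _ (z + s) nf.
have [m3 p3] := nonneg_mfun_autocorr _ (z - s) nf.
have t1 := integral_translate _ (- s) m1 p1.
have t2 := integral_translate _ (- s) m2 p2.
have shm (g : R -> \bar R) : measurable_fun setT g ->
    measurable_fun setT (fun x => g (x - s)).
  by move=> mg; apply: measurableT_comp => //; exact: measurable_funB.
have m1' := shm _ m1; have m2' := shm _ m2.
have -> : (2^-1%:E * autocorr f z +
    4^-1%:E * (autocorr f (z + s)%R + autocorr f (z - s)%R))%E =
  (4^-1%:E * ((autocorr f z + autocorr f z) +
     (autocorr f (z + s)%R + autocorr f (z - s)%R)))%E.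
  have q0 w : (0 <= autocorr f w)%E.
    by apply: integral_ge0 => x _; have [_] := nonneg_mfun_autocorr _ w nf.
  rewrite [in RHS]ge0_muleDr; [|exact: adde_ge0|exact: adde_ge0].
  suff -> : (2^-1%:E * autocorr f z = 4^-1%:E * (autocorr f z + autocorr f z))%E by [].
  have := q0 z; move: (autocorr f z) => q q0'.
  have -> : 2^-1%:E = (4^-1%:E + 4^-1%:E)%E :> \bar R by congr (_%:E); field.
  by rewrite ge0_muleDl ?lee_fin// ge0_muleDr.
rewrite /autocorr -{1}t1 -t2 -!ge0_integralD//;
  try by [move=> x _; exact: adde_ge0 | exact: emeasurable_funD].
rewrite -ge0_integralZl_EFin//.
- apply: eq_integral => x _; congr (_%:E); rewrite /step.
  rewrite (_ : x - s + (z + s) = x + z); last by ring.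
  rewrite (_ : x - s + z = x + z - s); last by ring.
  rewrite (_ : x + (z - s) = x + z - s); last by ring.
  by field.
- by move=> x _; rewrite !adde_ge0.
- by do 2 apply: emeasurable_funD.
Qed.

(** A half step averages f with a translate of itself, and the square is
convex. *)
Lemma autocorr_step0_le s f : nonneg_mfun f -> (autocorr (step s f) 0 <= autocorr f 0)%E.
Proof.
move=> nf; have [m1 p1] := nonneg_mfun_autocorr _ 0 nf.
have t1 := integral_translate _ (- s) m1 p1.
have m1' : measurable_fun setT (fun x => (f (x - s) * f (x - s + 0))%:E).
  apply: (measurableT_comp m1); exact: measurable_funB.
have [ms ps] := nonneg_mfun_autocorr _ 0 (nonneg_mfun_step s _ nf).
apply: (@le_trans _ _ (\int[mu]_x (2^-1%:E * ((f x * f (x + 0))%:E +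
   (f (x - s) * f (x - s + 0))%:E)))%E).
  apply: ge0_le_integral => //.
    by apply: measurable_funeM; exact: emeasurable_funD.
  move=> x _; rewrite -EFinD -EFinM lee_fin /step !addr0.
  by have := sqr_ge0 (f x - f (x - s)); nra.
rewrite ge0_integralZl_EFin//; last 2 first.
- by move=> x _; rewrite adde_ge0.
- exact: emeasurable_funD.
rewrite ge0_integralD// t1 -/(autocorr f 0).
have : (0 <= autocorr f 0)%E by exact: integral_ge0.
move: (autocorr f 0) => q q0; rewrite -[leRHS]mul1e.
have -> : 1%E = (2^-1%:E + 2^-1%:E)%E :> \bar R by congr (_%:E); field.
by rewrite ge0_muleDl ?lee_fin// ge0_muleDr.
Qed.

Lemma step_comm s t f : step s (step t f) = step t (step s f).
Proof.
apply/funext => x; rewrite /step (_ : x - s - t = x - t - s); last by ring.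
by field.
Qed.

Lemma step_stepsC s l f : step s (steps l f) = steps l (step s f).
Proof. by elim: l => //= t l <-; rewrite step_comm. Qed.

(** Half steps commute, so each omitted one can be made outermost, where it only
decreases the L2 norm. This is what allows a sparse set of digits to control
the whole sum. *)
Lemma autocorr_subseq l' l f : nonneg_mfun f -> subseq l' l ->
  (autocorr (steps l f) 0 <= autocorr (steps l' f) 0)%E.
Proof.
elim: l l' f => [|s l IH] l' f nf; first by rewrite subseq0 => /eqP ->.
case: l' => [_|t l'] /=.
  by apply: le_trans (autocorr_step0_le _ _ (nonneg_mfun_steps _ _ nf)) 
    (IH _ _ nf (sub0seq _)).
case: eqP => [->|_] sub.
  by rewrite !step_stepsC; apply: IH => //; exact: nonneg_mfun_step.
exact: le_trans (autocorr_step0_le _ _ (nonneg_mfun_steps _ _ nf)) (IH _ _ nf sub).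
Qed.

Definition plateau r x : R := (`|x| <= r)%R%:R.

Lemma nonneg_mfun_plateau r : nonneg_mfun (plateau r).
Proof.
split; last by move=> x; rewrite /plateau ler0n.
rewrite (_ : plateau r = \1_(`[- r, r]%classic)); first exact: measurable_indic.
apply/funext => x; rewrite indicE /plateau ler_norml.
by congr ((nat_of_bool _)%:R); apply/idP/idP; rewrite ?inE /= in_itv.
Qed.

Lemma autocorr_walk r l z : 0 <= r ->
  (autocorr (steps l (plateau r)) z <= (2 * r * walk (2 * r) l z)%:E)%E.
Proof.
move=> r0; elim: l z => [|s l IH] z.
  have [m1 p1] := nonneg_mfun_autocorr _ z (nonneg_mfun_plateau r).
  rewrite /autocorr /=.
  apply: (@le_trans _ _ (\int[mu]_x
     ((`|z| <= 2 * r)%R%:R%:E * (\1_(`[- r, r]%classic) x)%:E))%E).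
    apply: ge0_le_integral => //.
      by apply: measurable_funeM; apply/measurable_EFinP; exact: measurable_indic.
    move=> x _; rewrite -EFinM lee_fin /plateau.
    case: (boolP (`|x| <= r)) => xr; last by rewrite mul0r mulr_ge0.
    case: (boolP (`|x + z| <= r)) => xz; last by rewrite mulr0 mulr_ge0.
    rewrite indicE mem_set ?mulr1 /=; last by rewrite in_itv/= -ler_norml.
    have := ler_normB (x + z) x; rewrite addrAC subrr add0r => zz.
    by rewrite (_ : `|z| <= 2 * r)//; lra.
  rewrite ge0_integralZl_EFin//; last by apply/measurable_EFinP; exact: measurable_indic.
  rewrite integral_indic// setIT [X in (_ * X)%E](_ : _ = mu `[- r, r]%classic)//.
  rewrite lebesgue_measure_itv/= lte_fin.
  case: ifPn => h; last by rewrite mule0 lee_fin !mulr_ge0.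
  by rewrite -EFinB -EFinM lee_fin mulrC; apply: ler_wpM2r => //; lra.
rewrite autocorr_step; last exact: nonneg_mfun_steps (nonneg_mfun_plateau r).
have -> : (2 * r * walk (2 * r) (s :: l) z)%:E =
  (2^-1%:E * (2 * r * walk (2 * r) l z)%:E + 4^-1%:E *
   ((2 * r * walk (2 * r) l (z + s)%R)%:E + (2 * r * walk (2 * r) l (z - s)%R)%:E))%E.
  by congr (_%:E); rewrite /=; field.
by apply: leeD; apply: lee_wpmul2l; rewrite ?lee_fin//; apply: leeD.
Qed.

End steps.

(** * The Bernoulli convolution and the number of branches *)
Section distribution.
Context {R : realType}.
Notation mu := (@lebesgue_measure R).
Variable b : R.
Hypothesis b_gt1 : 1 < b.
Hypothesis b_lt2 : b < 2.
Implicit Types (x y r s : R) (n : nat) (f g : R -> R).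

Let c : R := (b - 1)^-1.

Let b_gt0 : 0 < b. Proof. exact: lt_trans b_gt1. Qed.

Let c_gt1 : 1 < c.
Proof. by rewrite /c invf_gt1 ?subr_gt0// ltrBlDr; move: b_lt2; lra. Qed.

Let c_gt0 : 0 < c. Proof. exact: lt_trans c_gt1. Qed.

Let bcE : b * c = c + 1.
Proof. by rewrite /c; field; move: b_gt1; lra. Qed.

Let bn_gt0 n : 0 < b ^+ n. Proof. exact: exprn_gt0. Qed.

(** The transfer operator of the two branches x -> b x and x -> b x - 1. *)
Definition branch (b : R) f x : R := f (b * x) + f (b * x - 1).

Lemma iter_branch_le f g n x : (forall y, f y <= g y) ->
  iter n (branch b) f x <= iter n (branch b) g x.
Proof. by move=> fg; elim: n x => //= n IH x; apply: lerD. Qed.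

Lemma iter_branch_lin f g (a : R) n x :
  iter n (branch b) (fun y => f y + a * g y) x =
  iter n (branch b) f x + a * iter n (branch b) g x.
Proof. by elim: n x => //= n IH x; rewrite /branch !IH; ring. Qed.

Lemma iter_branch_shift f s n x :
  iter n (branch b) (fun y => f (y + s)) x = iter n (branch b) f (x + s / b ^+ n).
Proof.
elim: n x => [|n IH] x /=; first by rewrite divr1.
rewrite /branch !IH.
have e : b * (x + s / b ^+ n.+1) = b * x + s / b ^+ n.
  by rewrite exprS; field; rewrite !gt_eqF.
by rewrite e [b * x + _ - 1]addrAC.
Qed.

Definition cdf_step f x := branch b f x / 2.
Definition heaviside x : R := (0 <= x)%R%:R.
Definition bcdf_approx n : R -> R := iter n cdf_step heaviside.
(** The distribution function of the sum of the b^-k e_k, for independent fair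
coins e_k in {0,1}: the approximations, obtained by cutting the sum after n
terms, decrease because the terms are nonnegative. *)
Definition bcdf x : R := inf (range (fun n => bcdf_approx n x)).

Lemma bcdf_approxS n x :
  bcdf_approx n.+1 x = (bcdf_approx n (b * x) + bcdf_approx n (b * x - 1)) / 2.
Proof. by []. Qed.

Lemma bcdf_approx_homo n x y : x <= y -> bcdf_approx n x <= bcdf_approx n y.
Proof.
elim: n x y => [|n IH] x y xy.
  rewrite /bcdf_approx/= /heaviside; case: (lerP 0 x) => x0; last by rewrite ler0n.
  by rewrite (le_trans x0 xy).
have bxy : b * x <= b * y by rewrite ler_pM2l.
by rewrite !bcdf_approxS ler_pM2r// lerD// IH// lerD2r.
Qed.

Lemma bcdf_approx_ge0 n x : 0 <= bcdf_approx n x.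
Proof.
elim: n x => [|n IH] x; first by rewrite /bcdf_approx/= /heaviside ler0n.
by rewrite bcdf_approxS divr_ge0// addr_ge0.
Qed.

Lemma bcdf_approx_le1 n x : bcdf_approx n x <= 1.
Proof.
elim: n x => [|n IH] x; first by rewrite /bcdf_approx/= /heaviside; case: (0 <= x).
by rewrite bcdf_approxS; have := IH (b * x); have := IH (b * x - 1); lra.
Qed.

Lemma bcdf_approx_neg n x : x < 0 -> bcdf_approx n x = 0.
Proof.
elim: n x => [|n IH] x x0; first by rewrite /bcdf_approx/= /heaviside leNgt x0.
have bx : b * x < 0 by rewrite pmulr_rlt0.
by rewrite bcdf_approxS !IH ?addr0 ?mul0r//; lra.
Qed.

Lemma bcdf_approx_one n x : c <= x -> bcdf_approx n x = 1.
Proof.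
elim: n x => [|n IH] x x0.
  by rewrite /bcdf_approx/= /heaviside (_ : 0 <= x)//; have := c_gt1; lra.
have bx : b * c <= b * x by rewrite ler_pM2l.
by rewrite bcdf_approxS !IH; move: bx; rewrite bcE; lra.
Qed.

Lemma bcdf_approx_anti n x : bcdf_approx n.+1 x <= bcdf_approx n x.
Proof.
elim: n x => [|n IH] x; last first.
  by rewrite bcdf_approxS [bcdf_approx n.+1 x]bcdf_approxS ler_pM2r// lerD.
case: (ltP x 0) => x0; first by rewrite !bcdf_approx_neg.
by rewrite (_ : bcdf_approx 0 x = 1) ?bcdf_approx_le1// /bcdf_approx/= /heaviside x0.
Qed.

Lemma bcdf_approx_cvg x : bcdf_approx n x @[n --> \oo] --> bcdf x.
Proof.
apply: nonincreasing_cvgn.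
  by apply/nonincreasing_seqP => n; exact: bcdf_approx_anti.
by exists 0 => _ [n _ <-]; exact: bcdf_approx_ge0.
Qed.

Lemma bcdf_le_approx n x : bcdf x <= bcdf_approx n x.
Proof.
by apply: ge_inf; [exists 0 => _ [m _ <-]; exact: bcdf_approx_ge0|exists n].
Qed.

Lemma bcdf_ge0 x : 0 <= bcdf x.
Proof.
by apply: lb_le_inf; [exists (bcdf_approx 0 x), 0%N|move=> _ [n _ <-]; exact: bcdf_approx_ge0].
Qed.

Lemma bcdf_le1 x : bcdf x <= 1.
Proof. exact: le_trans (bcdf_le_approx 0 x) (bcdf_approx_le1 0 x). Qed.

Lemma bcdf_neg x : x < 0 -> bcdf x = 0.
Proof.
by move=> x0; apply/eqP; rewrite eq_le bcdf_ge0 andbT -(bcdf_approx_neg 0 _ x0) bcdf_le_approx.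
Qed.

Lemma bcdf_one x : c <= x -> bcdf x = 1.
Proof.
move=> cx; apply/eqP; rewrite eq_le bcdf_le1/=.
apply: lb_le_inf; first by exists (bcdf_approx 0 x), 0%N.
by move=> _ [n _ <-]; rewrite bcdf_approx_one.
Qed.

Lemma bcdf_homo x y : x <= y -> bcdf x <= bcdf y.
Proof.
move=> xy; apply: lb_le_inf; first by exists (bcdf_approx 0 y), 0%N.
by move=> _ [n _ <-]; exact: le_trans (bcdf_le_approx n x) (bcdf_approx_homo _ _ _ xy).
Qed.

Lemma bcdf_selfsim x : bcdf x = (bcdf (b * x) + bcdf (b * x - 1)) / 2.
Proof.
have h1 : bcdf_approx n.+1 x @[n --> \oo] --> bcdf x.
  by rewrite (cvg_shiftS (fun n => bcdf_approx n x)); exact: bcdf_approx_cvg.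
have h2 : bcdf_approx n.+1 x @[n --> \oo] --> (bcdf (b * x) + bcdf (b * x - 1)) / 2.
  by apply: cvgMl; apply: cvgD; exact: bcdf_approx_cvg.
exact: (cvg_unique _ h1 h2).
Qed.

Lemma bcdf_approx_stable n x : exists2 d, 0 < d &
  forall y, x <= y -> y < x + d -> bcdf_approx n y = bcdf_approx n x.
Proof.
elim: n x => [|n IH] x.
  rewrite /bcdf_approx/= /heaviside; case: (lerP 0 x) => x0.
    by exists 1 => // y xy _; rewrite (le_trans x0 xy).
  by exists (- x); [lra|move=> y _; rewrite subrr leNgt => ->].
have [d1 d10 h1] := IH (b * x); have [d2 d20 h2] := IH (b * x - 1).
exists (Num.min d1 d2 / b); first by rewrite divr_gt0// lt_min d10.
move=> y xy; rewrite -ltrBlDl ltr_pdivlMr// lt_min => /andP[yd1 yd2].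
have bxy : b * x <= b * y by rewrite ler_pM2l.
rewrite !bcdf_approxS (h1 (b * y))//; last by move: yd1; rewrite mulrC mulrBr; lra.
by rewrite (h2 (b * y - 1))//; move: yd2; rewrite mulrC mulrBr; lra.
Qed.

(** An infimum of right-continuous nondecreasing functions is right-continuous;
the approximations are even locally constant on the right. *)
Lemma bcdf_right_continuous : right_continuous bcdf.
Proof.
move=> x; apply/cvgrPdist_lt => e e0.
have [_ [n _ <-] hn] : exists2 y, range (fun n => bcdf_approx n x) y & y < bcdf x + e.
  apply: inf_adherent => //; split; first by exists (bcdf_approx 0 x), 0%N.
  by exists 0 => _ [m _ <-]; exact: bcdf_approx_ge0.
have [d d0 hd] := bcdf_approx_stable n x.
near=> y.
have xy : x <= y by near: y; exact: nbhs_right_ge.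
have yd : y < x + d by near: y; apply: nbhs_right_lt; lra.
rewrite ltr_distlC; have := bcdf_homo _ _ xy; have := bcdf_le_approx n y.
by rewrite hd// => ? ?; apply/andP; split; lra.
Unshelve. all: by end_near. Qed.

(** Near 0 self-similarity reads F(t) = F(b t) / 2, so F(b^-(n+1)) <= 2^-n, while
b^-n decays more slowly because b < 2. *)
Lemma bcdf_small : exists2 e, 0 < e & bcdf e * (e + c) < e.
Proof.
have Fb n : bcdf (b ^- n.+1) <= 2 ^- n.
  elim: n => [|n IH]; first by rewrite expr0 invr1 bcdf_le1.
  have -> : bcdf (b ^- n.+2) = bcdf (b ^- n.+1) / 2.
    rewrite bcdf_selfsim [in LHS]exprS invfM mulVKf ?gt_eqF//.
    rewrite [X in _ + X]bcdf_neg ?addr0// subr_lt0 invf_lt1//.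
    by rewrite exprn_egt1.
  by rewrite [2 ^+ _]exprSr invfM ler_pM2r.
have hb : `|b / 2| < 1 by rewrite ger0_norm ?ltr_pdivrMr ?mul1r// divr_ge0// ltW.
have := cvg_expr hb => /cvgrPdist_lt/(_ (b * (1 + c))^-1).
have bc0 : 0 < b * (1 + c) by rewrite mulr_gt0//; have := c_gt1; lra.
rewrite invr_gt0 => /(_ bc0)[n _ /(_ n (leqnn _))] /=.
rewrite sub0r normrN ger0_norm; last by rewrite exprn_ge0//; move: b_gt0; lra.
rewrite -[ltRHS]mul1r ltr_pdivlMr// => hn.
exists (b ^- n.+1); first by rewrite invr_gt0.
apply: le_lt_trans (_ : 2 ^- n * (1 + c) < _).
  apply: ler_pM => //; first exact: bcdf_ge0.
    by apply: addr_ge0; [rewrite invr_ge0 ltW|exact: ltW].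
  by rewrite lerD2r invf_le1// exprn_ege1// ltW.
rewrite -[ltRHS]mul1r ltr_pdivlMr//; apply: le_lt_trans hn.
rewrite exprMn exprVn exprS; lra.
Qed.

Lemma iter_branch_bcdf n x : iter n (branch b) bcdf x = 2 ^+ n * bcdf x.
Proof.
elim: n x => [|n IH] x; first by rewrite mul1r.
by rewrite iterS /branch !IH -mulrDr [bcdf x]bcdf_selfsim exprSr; field.
Qed.

Lemma iter_branch_diff s t n x :
  iter n (branch b) (fun y => bcdf (y + s) - bcdf (y + t)) x =
  2 ^+ n * (bcdf (x + s / b ^+ n) - bcdf (x + t / b ^+ n)).
Proof.
rewrite (_ : (fun y => _) = fun y => bcdf (y + s) + (-1) * bcdf (y + t)); last first.
  by apply/funext => y; rewrite mulN1r.
rewrite iter_branch_lin !iter_branch_shift !iter_branch_bcdf.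
by ring.
Qed.

Definition branch_count n : R -> R := iter n (branch b) (fun x => (0 <= x <= c)%R%:R).

(** After n branches this is a pointwise inequality: if y lies in [0, c] the
indicator is 1; if -e <= y < 0 the increment is F(y + e) <= F(e), whereas
F(y + e + c) = 1; for all other y the increment vanishes. *)
Lemma branch_count_lower e n x : 0 <= e ->
  2 ^+ n * (bcdf (x + e / b ^+ n) - bcdf x) <=
  branch_count n x + bcdf e * (2 ^+ n * (bcdf (x + (e + c) / b ^+ n) - bcdf x)).
Proof.
move=> e0.
have := iter_branch_diff e 0 n x; have := iter_branch_diff (e + c) 0 n x.
rewrite !mul0r !addr0 => <- <-; rewrite -iter_branch_lin.
apply: iter_branch_le => y; rewrite addr0.
have c0 := c_gt1.
have F0 := bcdf_ge0 e.
have dec : 0 <= bcdf (y + (e + c)) - bcdf y by rewrite subr_ge0 bcdf_homo//; lra.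
have [y0|y0] := ltP y 0.
  rewrite [bcdf y]bcdf_neg// !subr0 add0r.
  have [ye|ye] := ltP (y + e) 0.
    by rewrite [leLHS]bcdf_neg// mulr_ge0// bcdf_ge0.
  rewrite [bcdf (y + (e + c))]bcdf_one ?mulr1; last lra.
  by apply: bcdf_homo; lra.
have [yc|yc] /= := leP y c.
  by have := bcdf_le1 (y + e); have := bcdf_ge0 y; have := mulr_ge0 F0 dec; lra.
rewrite [bcdf (y + e)]bcdf_one; last by lra.
by rewrite [bcdf y]bcdf_one ?subrr ?addr_ge0 ?mulr_ge0 ?subr_ge0//;
  [rewrite (bcdf_one (y + (e + c))) ?bcdf_le1//; lra|exact: ltW].
Qed.

(** Pointwise: for y in [0, c] one has y + c >= c, where F is 1, and
y - 2c < 0, where F is 0. *)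
Lemma branch_count_upper n x :
  branch_count n x <= 2 ^+ n * (bcdf (x + c / b ^+ n) - bcdf (x + (- (2 * c)) / b ^+ n)).
Proof.
rewrite -iter_branch_diff; apply: iter_branch_le => y.
have c0 := c_gt1.
have [/andP[y0 yc]|_] := boolP (0 <= y <= c).
  by rewrite bcdf_one ?bcdf_neg ?subr0//; lra.
by rewrite subr_ge0 bcdf_homo//; lra.
Qed.

Lemma branch_count_ge0 n x : 0 <= branch_count n x.
Proof.
elim: n x => [|n IH] x; first by rewrite /branch_count/= ler0n.
by rewrite /branch_count iterS; apply: addr_ge0; exact: IH.
Qed.

Lemma branch_countS n x :
  branch_count n.+1 x = branch_count n (b * x) + branch_count n (b * x - 1).
Proof. by []. Qed.

Definition bcdf_scaled n x : R := bcdf (b ^+ n * x).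

(** Self-similarity, with the n coins taken out one by one. *)
Lemma bcdf_steps n x : bcdf x = steps [seq b ^- i | i <- iota 1 n] (bcdf_scaled n) x.
Proof.
elim: n x => [|n IH] x; first by rewrite /= /bcdf_scaled mul1r.
have e : step (b ^- (1 + n)) (bcdf_scaled (n + 1)) = bcdf_scaled n.
  apply/funext => y; rewrite /step /bcdf_scaled addn1 add1n [RHS]bcdf_selfsim mulrBr.
  by rewrite divff ?gt_eqF// exprS mulrA.
by rewrite IH -[n.+1]addn1 iotaD map_cat /steps foldr_cat /= e.
Qed.

Lemma steps_le l f g x : (forall y, f y <= g y) -> steps l f x <= steps l g x.
Proof.
move=> fg; elim: l x => //= s l IH x.
by rewrite /step ler_pM2r// lerD.
Qed.

Lemma steps_diff l f r x :
  steps l (fun y => f (y + r) - f y) x = steps l f (x + r) - steps l f x.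
Proof.
elim: l x => //= s l IH x; rewrite /step !IH (_ : x - s + r = x + r - s); last by ring.
by field.
Qed.

(** Beyond n digits the sum contributes at most c b^-n <= r, so an increment over
length r can only see the partial sums within distance r. *)
Lemma bcdf_increment_le n r x : 0 <= r -> c / b ^+ n <= r ->
  bcdf (x + r) - bcdf x <= steps [seq b ^- i | i <- iota 1 n] (plateau r) x.
Proof.
move=> r0 cr; rewrite !(bcdf_steps n) -steps_diff; apply: steps_le => y.
rewrite /bcdf_scaled /plateau.
have [yr|] := boolP (`|y| <= r).
  by rewrite /= lerBlDr (le_trans (bcdf_le1 _))// lerDl bcdf_ge0.
rewrite ler_norml negb_and -!ltNge => /orP[yr|yr].
  have y0 : y < 0 by rewrite (lt_le_trans yr)// oppr_le0.
  rewrite [bcdf (b ^+ n * y)]bcdf_neg ?pmulr_rlt0 ?bn_gt0//.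
  by rewrite bcdf_neg ?subrr// pmulr_rlt0 ?bn_gt0// -ltrBrDr sub0r.
have h : c <= b ^+ n * y by rewrite -ler_pdivrMl// mulrC (le_trans cr)// ltW.
by rewrite !bcdf_one ?subrr//; apply: (le_trans h); rewrite ler_pM2l// lerDl.
Qed.

Lemma subseq_iota (s : seq nat) n : sorted ltn s -> all (fun i => 1 <= i <= n)%N s ->
  subseq s (iota 1 n).
Proof.
move=> ss sn; have -> : s = [seq i <- iota 1 n | i \in s].
  apply: (irr_sorted_eq ltn_trans ltnn) => //.
    by apply: sorted_filter; [exact: ltn_trans|exact: iota_ltn_sorted].
  move=> i; rewrite mem_filter mem_iota add1n ltnS.
  have [/= si|//] := boolP (i \in s).
  by have /allP/(_ _ si) -> := sn.
exact: filter_subseq.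
Qed.

Lemma gap_blocks_sorted D k N : (1 < D)%N ->
  sorted ltn (gap_blocks D k N) /\ all (leq k) (gap_blocks D k N).
Proof.
move=> D1; elim: N k => [|N IH] k //=.
have [s a] := IH (k + D)%N.
have a' : all (leq k.+2) (gap_blocks D (k + D) N).
  by apply: sub_all a => i; lia.
split.
  rewrite ltnSn /=; case: (gap_blocks D (k + D) N) s a' => //= i l -> /andP[].
  by rewrite andbT.
by rewrite leqnn leqnSn /=; apply: sub_all a => i; lia.
Qed.

(** The increment is dominated by half steps applied to the indicator of
[-r, r]; keeping only the exponents p i with i in the blocks, the squared norm
becomes the collision probability of the walk. The number n of digits may
depend on b, since only the kept exponents enter the bound. *)
Lemma increment_energy p D : (0 < p)%N -> (1 < D)%N ->
  (exists K, forall m0, exists2 m, (m0 <= m)%N & energy p D m b <= K) ->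
  exists2 K, 0 <= K & forall d, 0 < d -> exists r, [/\ 0 < r, r < d &
    (\int[mu]_x ((bcdf (x + r) - bcdf x) ^+ 2)%:E <= (K * r ^+ 2)%:E)%E].
Proof.
move=> p0 D1 [K hK].
have en0 m : 0 <= energy p D m b by rewrite mulr_ge0 ?exprn_ge0// walk_ge0.
exists (2 * K).
  by have [m _ ?] := hK 0%N; rewrite mulr_ge0// (le_trans (en0 m)).
move=> d d0.
have half : `|2^-1 : R| < 1 by rewrite ger0_norm; lra.
have := cvg_expr half => /cvgrPdist_lt/(_ _ d0)[m0 _ hm0].
have [m mm0 em] := hK m0.
pose r : R := 2 ^- m; exists r.
have r0 : 0 < r by rewrite invr_gt0 exprn_gt0.
split => //.
  by have := hm0 m mm0; rewrite /= sub0r normrN exprVn ger0_norm// ltW.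
pose s := [seq (p * i)%N | i <- gap_blocks D 1 m].
have [gs ga] := gap_blocks_sorted D 1 m D1.
have ss : sorted ltn s.
  rewrite sorted_map; apply: sub_sorted gs => i j /=.
  by rewrite /relpre/= ltn_pmul2l.
have vb : `|b^-1| < 1 by rewrite ger0_norm ?invr_ge0 ?ltW// invf_lt1.
have rc0 : 0 < r / c by rewrite divr_gt0//; have := c_gt1; lra.
have := cvg_expr vb => /cvgrPdist_lt/(_ _ rc0)[n0 _ hn0].
pose n := maxn n0 (\max_(i <- s) i).
have sn : subseq s (iota 1 n).
  apply: subseq_iota => //; apply/allP => i si; apply/andP; split.
    by move: si => /mapP[j /(allP ga) j1 ->]; rewrite muln_gt0 p0.
  by rewrite leq_max (leq_bigmax_seq (F := id))// orbT.
have cn : c / b ^+ n <= r.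
  have hn : b ^- n < r / c.
    have := hn0 n (leq_maxl _ _); rewrite /= sub0r normrN exprVn ger0_norm//.
    by rewrite invr_ge0 ltW.
  by move: hn; rewrite ltr_pdivlMr// mulrC => /ltW.
have [mS S0] := nonneg_mfun_steps [seq b ^- i | i <- iota 1 n] _ (nonneg_mfun_plateau r).
apply: (@le_trans _ _ (autocorr (steps [seq b ^- i | i <- iota 1 n] (plateau r)) 0)).
  have mF : measurable_fun setT bcdf.
    by apply: nondecreasing_measurable => // x y; exact: bcdf_homo.
  apply: ge0_le_integral => //.
  - by move=> x _; rewrite lee_fin sqr_ge0.
  - apply/measurable_EFinP; apply: measurable_funX; apply: measurable_funB => //.
    by apply: measurableT_comp => //; exact: measurable_funD.
  - by have [] := nonneg_mfun_autocorr _ 0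
      (nonneg_mfun_steps [seq b ^- i | i <- iota 1 n] _ (nonneg_mfun_plateau r)).
  - move=> x _; rewrite lee_fin addr0 expr2.
    have h := bcdf_increment_le n r x (ltW r0) cn.
    have h0 : 0 <= bcdf (x + r) - bcdf x by rewrite subr_ge0 bcdf_homo//; lra.
    exact: ler_pM.
apply: le_trans (autocorr_subseq _ _ _ (nonneg_mfun_plateau r) (map_subseq _ sn)) _.
apply: le_trans (autocorr_walk _ _ _ (ltW r0)) _.
rewrite lee_fin.
have -> : [seq b ^- i | i <- s] = [seq neg_power p k b | k <- gap_blocks D 1 m].
  by rewrite -map_comp; apply: eq_map => i /=; rewrite /neg_power exprM.
have eE : walk (2 * r) [seq neg_power p k b | k <- gap_blocks D 1 m] 0 = r * energy p D m b.
  by rewrite /energy mulrA mulVf ?mul1r// expf_neq0.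
rewrite eE; have r20 : 0 <= 2 * r * r by rewrite !mulr_ge0// ltW.
have := ler_wpM2l r20 em; rewrite expr2; lra.
Qed.

End distribution.

(** * Words that extend to expansions *)
Section prefixes.
Context {R : realType}.
Variable b : R.
Hypothesis b_gt1 : 1 < b.
Hypothesis b_lt2 : b < 2.
Implicit Types (x : R) (n : nat) (d : nat -> bool).

Let b_gt0 : 0 < b. Proof. exact: lt_trans b_gt1. Qed.
Let b1_gt0 : 0 < b - 1. Proof. by rewrite subr_gt0. Qed.
Let bn_gt0 n : 0 < b ^+ n. Proof. exact: exprn_gt0. Qed.

Lemma beta_expansion_cons x d :
  beta_expansion b x d <-> beta_expansion b (b * x - (d 0%N)%:R) (d \o succn).
Proof.
rewrite /beta_expansion.
pose S := series (fun k : nat => (d k)%:R * b ^- k.+1).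
pose S' := series (fun k : nat => (d k.+1)%:R * b ^- k.+1).
have SE n : S n.+1 = (S' n + (d 0%N)%:R) / b.
  rewrite /S /S' /series/= big_nat_recl// expr1 addrC mulrDl; congr (_ + _).
  rewrite mulr_suml; apply: eq_bigr => k _.
  by rewrite -mulrA -invfM -exprSr.
have SE' n : S' n = b * S n.+1 - (d 0%N)%:R.
  by rewrite SE mulrC divfK ?gt_eqF// addrK.
rewrite -/S -/S'; rewrite -(cvg_shiftS S); split => h.
  rewrite (_ : S' = fun n => b * S n.+1 - (d 0%N)%:R); last exact/funext.
  by apply: cvgB; [apply: cvgMr|exact: cvg_cst].
rewrite (_ : x = ((b * x - (d 0%N)%:R) + (d 0%N)%:R) / b); last first.
  by rewrite subrK mulrC mulKf// gt_eqF.
rewrite (_ : [sequence S n.+1]_n = fun n => (S' n + (d 0%N)%:R) / b); last exact/funext.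
by apply: cvgMl; apply: cvgD => //; exact: cvg_cst.
Qed.

Definition in_interval x : bool := 0 <= x <= (b - 1)^-1.

Lemma expansion_in_interval x d : beta_expansion b x d -> in_interval x.
Proof.
rewrite /beta_expansion => h.
have ub n : \sum_(0 <= k < n) (d k)%:R * b ^- k.+1 <= (b - 1)^-1 * (1 - b ^- n).
  elim: n => [|n IH]; first by rewrite big_geq// invr1 subrr mulr0.
  rewrite big_nat_recr//=.
  have -> : (b - 1)^-1 * (1 - b ^- n.+1) = (b - 1)^-1 * (1 - b ^- n) + b ^- n.+1.
    by rewrite exprS; field; rewrite !gt_eqF.
  by apply: lerD => //; case: (d n); rewrite ?mul1r// mul0r invr_ge0 ltW.
apply/andP; split.
  rewrite -(cvg_lim _ h)//; apply: limr_ge; first by apply/cvg_ex; exists x.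
  apply: nearW => n; apply: sumr_ge0 => k _.
  by rewrite mulr_ge0// invr_ge0 ltW.
rewrite -(cvg_lim _ h)//; apply: limr_le; first by apply/cvg_ex; exists x.
apply: nearW => n; apply: (le_trans (ub n)).
by rewrite -[leRHS]mulr1 ler_pM2l ?invr_gt0// gerBl invr_ge0 ltW.
Qed.

(** The remainders of the greedy expansion, rescaled. *)
Fixpoint greedy x n : R :=
  if n is n'.+1 then b * greedy x n' - (1 <= b * greedy x n')%R%:R else x.

(** If the digit is 0 the new remainder is below 1 <= c because b < 2; if it is 1
the new remainder is at most b c - 1 = c. *)
Lemma greedy_in_interval x n : in_interval x -> in_interval (greedy x n).
Proof.
move=> xI; elim: n => //= n /andP[y0 yc].
set y := greedy x n in y0 yc *.
have by0 : 0 <= b * y by rewrite mulr_ge0// ltW.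
have bc : b * y <= (b - 1)^-1 + 1.
  apply: (@le_trans _ _ (b * (b - 1)^-1)); first by rewrite ler_pM2l.
  by rewrite le_eqVlt; apply/orP; left; apply/eqP; field; rewrite gt_eqF.
have c1 : 1 <= (b - 1)^-1 by rewrite invf_ge1// lerBlDr; move: b_lt2; lra.
rewrite /in_interval; case: (lerP 1 (b * y)) => h.
  by apply/andP; split; [rewrite subr_ge0|rewrite lerBlDr].
by rewrite subr0 by0/= (le_trans (ltW h)).
Qed.

Lemma interval_has_expansion x : in_interval x -> exists d, beta_expansion b x d.
Proof.
move=> xI; exists (fun n => 1 <= b * greedy x n)%R.
rewrite /beta_expansion.
have E n : series (fun k => (1 <= b * greedy x k)%R%:R * b ^- k.+1) n =
    x - greedy x n * b ^- n.
  elim: n => [|n IH]; first by rewrite /series/= big_geq// invr1 mulr1 subrr.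
  rewrite /series/= big_nat_recr//=; move: IH; rewrite /series/= => ->.
  by rewrite exprS; field; rewrite !gt_eqF.
rewrite (_ : series _ = fun n => x - greedy x n * b ^- n); last exact/funext.
rewrite -[X in _ --> X]subr0; apply: cvgB; first exact: cvg_cst.
have c0 : 0 <= (b - 1)^-1 by rewrite invr_ge0 ltW.
apply: (@squeeze_cvgr _ _ _ _ (fun=> 0) (fun n => (b - 1)^-1 * b^-1 ^+ n)).
- apply: nearW => n; have /andP[g0 gc] := greedy_in_interval x n xI.
  have bV : 0 < b ^- n by rewrite invr_gt0.
  by rewrite exprVn ler_pM2r// gc mulr_ge0// ltW.
- exact: cvg_cst.
- rewrite -[X in _ --> X](mulr0 (b - 1)^-1); apply: cvgMr; apply: cvg_expr.
  by rewrite ger0_norm ?invr_ge0 ?ltW// invf_lt1.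
Qed.

Lemma mem_beta_prefixes n x (w : n.-tuple bool) :
  reflect (exists d, beta_expansion b x d /\ forall i : 'I_n, tnth w i = d i)
    (w \in beta_prefixes n b x).
Proof. by rewrite inE; exact: asboolP. Qed.

Lemma prefix_count0 x : prefix_count 0 x b = in_interval x.
Proof.
rewrite /prefix_count; case: (boolP (in_interval x)) => xI.
  have [d hd] := interval_has_expansion x xI.
  rewrite (_ : beta_prefixes 0 b x = [set: 0.-tuple bool]%SET).
    by rewrite cardsT card_tuple expn0.
  apply/setP => w; rewrite finset.in_setT; apply/mem_beta_prefixes.
  by exists d; split => // -[].
apply/eqP; rewrite cards_eq0; apply/eqP/setP => w; rewrite finset.in_set0.
apply/negP => /mem_beta_prefixes[d [hd _]].
by move: xI; rewrite (expansion_in_interval x d).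
Qed.

Lemma mem_beta_prefixesS n x (a : bool) (w : n.-tuple bool) :
  ([tuple of a :: w] \in beta_prefixes n.+1 b x) =
  (w \in beta_prefixes n b (b * x - a%:R)).
Proof.
apply/mem_beta_prefixes/mem_beta_prefixes => -[d [hd dw]].
  have d0 : d 0%N = a by have := dw ord0; rewrite tnth0.
  exists (d \o succn); split.
    by move: hd => /beta_expansion_cons; rewrite d0.
  move=> i; have := dw (lift ord0 i); rewrite tnthS => ->.
  by rewrite /= /plateau.
exists (fun k => if k is k'.+1 then d k' else a); split.
  exact/beta_expansion_cons.
move=> i; case: (unliftP ord0 i) => [j ->|->]; last by rewrite tnth0.
by rewrite tnthS dw.
Qed.

(** Splitting off the first letter a turns expansions of x into expansions of
b x - a. *)
Lemma prefix_countS n x : prefix_count n.+1 x b =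
  (prefix_count n (b * x) b + prefix_count n (b * x - 1) b)%N.
Proof.
rewrite /prefix_count.
pose ext (a : bool) (w : n.-tuple bool) : n.+1.-tuple bool := [tuple of a :: w].
have ext_inj a : injective (ext a) by move=> u v /(congr1 val)[] /val_inj.
rewrite -[in RHS](card_imset _ (ext_inj false)) -(card_imset _ (ext_inj true)).
rewrite -cardsUI (_ : _ :&: _ = finset.set0)%SET ?cards0 ?addn0; last first.
  apply/setP => w; rewrite !inE; apply/negP => /andP[/imsetP[u _ ->] /imsetP[v _]].
  by move=> /(congr1 val)[].
congr #|pred_of_set _|; apply/setP => w.
rewrite [w]tuple_eta mem_beta_prefixesS finset.in_setU.
set a := thead w; set v := [tuple of behead w].
have E a' (A : {set n.-tuple bool}) :
    ([tuple of a :: v] \in ext a' @: A)%SET = (a == a') && (v \in A).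
  apply/imsetP/andP => [[u uA /(congr1 val)[-> vu]]|[/eqP -> vA]]; last by exists v.
  by split => //; rewrite (_ : v = u)//; exact: val_inj.
by rewrite !E; case: (a); rewrite /= ?orbF ?subr0.
Qed.

Lemma prefix_countE n x : (prefix_count n x b)%:R = branch_count b n x.
Proof.
elim: n x => [|n IH] x; first by rewrite prefix_count0.
by rewrite prefix_countS natrD !IH branch_countS.
Qed.

End prefixes.

(** * Bounded difference quotients in L2 give a density *)

Lemma tonelli_sections d1 d2 (T1 : measurableType d1) (T2 : measurableType d2)
    (R : realType) (m1 : {sigma_finite_measure set T1 -> \bar R})
    (m2 : {sigma_finite_measure set T2 -> \bar R}) (A : set (T1 * T2)) :
  measurable A ->
  (\int[m1]_x m2 (xsection A x) = \int[m2]_y m1 (ysection A y))%E.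
Proof.
move=> mA; have := indic_fubini_tonelli m1 m2 mA.
by rewrite indic_fubini_tonelli_FE// indic_fubini_tonelli_GE.
Qed.

Section absolute_continuity.
Context {R : realType}.
Notation mu := (@lebesgue_measure R).
Notation T := (measurableTypeR R).
Variable G : cumulativeBounded (0 : R) (1 : R).
Let nu := lebesgue_stieltjes_measure G.

Lemma stieltjes_itv_oc (u v : R) : u <= v -> nu `]u, v]%classic = (G v - G u)%:E.
Proof.
move=> uv; rewrite /nu /lebesgue_stieltjes_measure /measure_extension/=.
by rewrite measurable_mu_extE/= ?wlength_itv_bnd// ?EFinB//; exact: is_ocitv.
Qed.

Variables (U : set T) (mU : measurable U).

Definition strip (r : R) : set (T * T) :=
  [set z | U z.1 /\ (z.1 < z.2 /\ z.2 <= z.1 + r)].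

Lemma measurable_strip r : measurable (strip r).
Proof.
have -> : strip r = (fst @^-1` U) `&`
    ((fun z : T * T => (z.1 : R) < z.2) @^-1` [set true] `&`
     (fun z : T * T => (z.2 : R) <= z.1 + r) @^-1` [set true]).
  by apply/seteqP; split.
have m1 : measurable_fun setT (fst : T * T -> R) := measurable_fst.
have m2 : measurable_fun setT (snd : T * T -> R) := measurable_snd.
apply: measurableI; first by rewrite -[X in measurable X]setTI; exact: measurable_fst.
apply: measurableI.
  have := measurable_fun_ltr m1 m2.
  by move=> /(_ measurableT [set true] I); rewrite setTI.
have m3 : measurable_fun setT (fun z : T * T => (z.1 : R) + r).
  by apply: measurable_funD.
by have := measurable_fun_ler m2 m3 => /(_ measurableT [set true] I); rewrite setTI.
Qed.

Lemma ysection_strip (r : R) (y : T) :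
  ysection (strip r) y = U `&` `[(y : R) - r, (y : R)[%classic.
Proof.
apply/seteqP; split => x /=.
  rewrite in_itv/= => /set_mem[/= Ux [h1 h2]].
  by split => //; rewrite h1 andbT lerBlDr.
rewrite in_itv/= => -[Ux /andP[h1 h2]]; rewrite /ysection/=; apply/mem_set.
by split => //=; split => //; rewrite -lerBlDr.
Qed.

Lemma measurable_strip_length (r : R) :
  measurable_fun setT (fun y : T => mu (U `&` `[(y : R) - r, (y : R)[%classic)).
Proof.
rewrite (_ : (fun y : T => _) = mu \o ysection (strip r)).
  exact: measurable_fun_ysection (measurable_strip r).
by apply/funext => y /=; congr (mu _); exact/esym/ysection_strip.
Qed.

Lemma xsection_strip (r : R) (x : T) : x \in U ->
  xsection (strip r) x = `](x : R), (x : R) + r]%classic.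
Proof.
move=> xU; apply/seteqP; split => y /=.
  by move=> /set_mem[/= _ [h1 h2]]; rewrite in_itv/= h1.
rewrite in_itv/= => /andP[h1 h2]; apply/mem_set.
by split; [exact: set_mem|split].
Qed.

Lemma xsection_strip_out (r : R) (x : T) : x \notin U ->
  xsection (strip r) x = set0.
Proof.
move=> xU; rewrite -subset0 => y /set_mem[/= Ux _].
by move/negP: xU; apply; exact/mem_set.
Qed.

(** The two sides measure the strip x < y <= x + r over U in the two orders. *)
Lemma strip_fubini (r : R) : 0 < r ->
  (\int[nu]_y mu (U `&` `[(y : R) - r, (y : R)[%classic)%R =
   \int[mu]_(x in U) (G (x + r) - G x)%:E)%E.
Proof.
move=> r0.
transitivity (\int[nu]_y mu (ysection (strip r) y))%E.
  by apply: eq_integral => y _; congr (mu _); exact/esym/ysection_strip.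
transitivity (\int[mu]_x nu (xsection (strip r) x))%E.
  have e := @tonelli_sections _ _ _ _ _ mu nu _ (measurable_strip r).
  exact: esym e.
rewrite [RHS]integral_mkcond; apply: eq_integral => x _; rewrite patchE.
case: ifPn => xU; last first.
  by transitivity (nu set0); [congr (nu _); exact: xsection_strip_out|exact: measure0].
transitivity (nu `](x : R), (x : R) + r]%classic).
  by congr (nu _); exact: xsection_strip.
by apply: stieltjes_itv_oc; rewrite lerDl ltW.
Qed.

End absolute_continuity.

Section bounded_increments.
Context {R : realType}.
Notation mu := (@lebesgue_measure R).
Notation T := (measurableTypeR R).
Variable G : cumulativeBounded (0 : R) (1 : R).
Let nu := lebesgue_stieltjes_measure G.
Variable K : R.
Hypothesis increments : forall d, 0 < d -> exists r, [/\ 0 < r, r < d &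
  (\int[mu]_x ((G (x + r) - G x) ^+ 2)%:E <= (K * r ^+ 2)%:E)%E].

Let G_homo (x y : R) : x <= y -> G x <= G y.
Proof. exact: cumulative_is_nondecreasing. Qed.

Let mG : measurable_fun setT G.
Proof. by apply: nondecreasing_measurable => // x y; exact: G_homo. Qed.

Lemma increments_on (U : set T) (M r : R) : measurable U -> 0 < M -> 0 < r ->
  (\int[mu]_x ((G (x + r) - G x) ^+ 2)%:E <= (K * r ^+ 2)%:E)%E ->
  (r^-1%:E * \int[mu]_(x in U) (G (x + r) - G x)%:E <=
   M%:E * mu U + (K / (4 * M))%:E)%E.
Proof.
move=> mU M0 r0 hr.
have mD : measurable_fun setT (fun x : R => G (x + r) - G x).
  apply: measurable_funB => //; apply: measurableT_comp => //.
  exact: measurable_funD.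
have D0 x : 0 <= G (x + r) - G x by rewrite subr_ge0 G_homo// lerDl ltW.
have mDU : measurable_fun U (fun x : R => (G (x + r) - G x)%:E).
  by apply/measurable_EFinP; exact: measurable_funS mD.
have mD2 : measurable_fun setT (fun x : R => ((G (x + r) - G x) ^+ 2)%:E).
  by apply/measurable_EFinP; exact: measurable_funX.
have q0 : 0 <= (4 * M * r ^+ 2)^-1 by rewrite invr_ge0 !mulr_ge0 ?sqr_ge0 ?ltW.
rewrite -ge0_integralZl_EFin//; last 2 first.
- by move=> x _; rewrite lee_fin.
- by rewrite invr_ge0 ltW.
apply: (@le_trans _ _ (\int[mu]_(x in U)
   (M%:E + ((4 * M * r ^+ 2)^-1%:E * ((G (x + r) - G x) ^+ 2)%:E)))%E).
  apply: ge0_le_integral => //.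
  - by move=> x _; rewrite mule_ge0// lee_fin ?invr_ge0// ltW.
  - exact: measurable_funeM.
  - apply: emeasurable_funD; first exact: measurable_cst.
    by apply: measurable_funeM; exact: measurable_funS mD2.
  - move=> x _; rewrite -!EFinM -EFinD lee_fin.
    set t := G _ - G _.
    (* t / r <= M + (t / r)^2 / (4 M), by completing the square *)
    have -> : M + (4 * M * r ^+ 2)^-1 * t ^+ 2 =
        r^-1 * t + (4 * M * r ^+ 2)^-1 * (t - 2 * M * r) ^+ 2.
      by field; rewrite !gt_eqF.
    by rewrite lerDl mulr_ge0// sqr_ge0.
rewrite ge0_integralD//; last 3 first.
- by move=> x _; rewrite lee_fin ltW.
- by move=> x _; rewrite -EFinM lee_fin mulr_ge0// sqr_ge0.
- by apply: measurable_funeM; exact: measurable_funS mD2.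
rewrite integral_cst//; apply: leeD => //.
rewrite ge0_integralZl_EFin//; last 2 first.
- by move=> x _; rewrite lee_fin sqr_ge0.
- exact: measurable_funS mD2.
apply: (@le_trans _ _ ((4 * M * r ^+ 2)^-1%:E * (K * r ^+ 2)%:E)%E).
  apply: lee_wpmul2l; first by rewrite lee_fin.
  apply: le_trans hr; apply: ge0_subset_integral => //.
  by move=> x _; rewrite lee_fin sqr_ge0.
rewrite -EFinM lee_fin le_eqVlt; apply/orP; left; apply/eqP.
by field; rewrite !gt_eqF.
Qed.

(** The fraction of [y - r, y) covered by U tends to 1 as r decreases to 0 for
each y in the open set U, so by Fatou nu U is at most the lower limit of the
integrals over U of the difference quotients of G. *)
Lemma nu_open_le (U : set T) (M : R) : open (U : set R) -> 0 < M ->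
  (nu U <= M%:E * mu U + (K / (4 * M))%:E)%E.
Proof.
move=> oU M0; have mU : measurable U by exact: open_measurable.
have /choice[r hr] : forall i : nat, exists r, [/\ 0 < r, r < i.+1%:R^-1 &
  (\int[mu]_x ((G (x + r) - G x) ^+ 2)%:E <= (K * r ^+ 2)%:E)%E].
  by move=> i; apply: increments; rewrite invr_gt0.
pose u i (y : T) := ((r i)^-1%:E * mu (U `&` `[(y : R) - r i, (y : R)[%classic)%R)%E.
have m_u i : measurable_fun setT (u i).
  by apply: measurable_funeM; exact: measurable_strip_length.
have u0 i y : (0 <= u i y)%E.
  by rewrite mule_ge0// lee_fin invr_ge0; have [/ltW] := hr i.
have u_int_le i : (\int[nu]_(y in U) u i y <= M%:E * mu U + (K / (4 * M))%:E)%E.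
  have [r0 _ h2] := hr i.
  apply: le_trans (increments_on _ _ _ mU M0 r0 h2).
  apply: (@le_trans _ _ (\int[nu]_y u i y)%E).
    by apply: ge0_subset_integral => //.
  rewrite ge0_integralZl_EFin.
  - by rewrite strip_fubini.
  - exact: measurableT.
  - by move=> y _; exact: measure_ge0.
  - exact: measurable_strip_length.
  - by rewrite invr_ge0 ltW.
have lim1 y : U y -> (1%E <= limn_einf (u ^~ y))%E.
  move=> Uy; have /nbhs_ballP[e /= e0 he] : nbhs (y : R) U by exact: open_nbhs_nbhs.
  rewrite limn_einf_lim; apply: lime_ge; first exact: is_cvg_einfs.
  near=> n; apply: le_ereal_inf_tmp => _ [m /= nm <-].
  have [r0 r1 _] := hr m.
  have rme : r m < e.
    apply: (lt_trans r1); apply: le_lt_trans (_ : n.+1%:R^-1 < e).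
      by rewrite lef_pV2 ?posrE// ler_nat ltnS.
    by near: n; exact: near_infty_natSinv_lt (PosNum e0).
  rewrite /u.
  have -> : U `&` `[(y : R) - r m, (y : R)[%classic = `[(y : R) - r m, (y : R)[%classic.
    apply/setIidPr => z /=; rewrite in_itv/= => /andP[z1 z2]; apply: he.
    by rewrite /ball/= ltr_distlC; apply/andP; split; lra.
  rewrite lebesgue_measure_itv/= lte_fin gtrBl r0 -EFinB -EFinM lee_fin.
  by rewrite opprB addrCA subrr addr0 mulVf// gt_eqF.
rewrite -[leLHS]mul1e -integral_cst//.
apply: (@le_trans _ _ (\int[nu]_(y in U) limn_einf (u ^~ y))%E).
  apply: ge0_le_integral => //.
    rewrite /limn_einf; apply: measurableT_comp => //.
    apply: measurable_fun_limn_esup => m; apply: measurableT_comp => //.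
    exact: measurable_funS (m_u m).
apply: (le_trans (@fatou _ _ _ nu _ mU u _ _)) => //.
  by move=> i; exact: measurable_funS (m_u i).
rewrite limn_einf_lim; apply: lime_le; first exact: is_cvg_einfs.
apply: nearW => n; apply: le_trans (u_int_le n).
by apply: ereal_inf_lbound; exists n; rewrite /= ?leqnn.
Unshelve. all: by end_near. Qed.

(** An open neighbourhood of N of measure at most 1/M^2 has nu-measure at most
(1 + K/4)/M, and M is arbitrary. *)
Lemma nu_null (N : set T) : 0 <= K -> measurable N -> mu N = 0%E -> nu N = 0%E.
Proof.
move=> K0 mN N0; apply/eqP; rewrite eq_le measure_ge0 andbT.
apply/lee_addgt0Pr => e e0; rewrite add0e.
pose M := (1 + K / 4) / e.
have M0 : 0 < M by rewrite divr_gt0// ltr_pwDl// divr_ge0.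
have M2 : 0 < (M ^+ 2)^-1 by rewrite invr_gt0 exprn_gt0.
have fN : (mu N < +oo)%E by rewrite N0 ltry.
have [U [oU NU UN]] := @lebesgue_regularity_outer R N _ mN fN M2.
have mU : measurable U by exact: open_measurable.
have Ule : (mu U <= ((M ^+ 2)^-1)%:E)%E.
  rewrite (_ : mu U = mu (U `\` N)); first exact: ltW.
  rewrite (@measureDI _ _ _ mu U N mU mN) (_ : U `&` N = N); last exact/setIidPr.
  by rewrite [X in (_ + X)%E](_ : _ = 0%E) ?adde0.
apply: (@le_trans _ _ (nu U)); first by apply: le_measure; rewrite ?inE.
apply: (le_trans (nu_open_le _ _ oU M0)).
apply: (@le_trans _ _ (M%:E * ((M ^+ 2)^-1)%:E + (K / (4 * M))%:E)%E).
  by apply: leeD => //; apply: lee_wpmul2l => //; rewrite lee_fin ltW.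
rewrite -EFinM -EFinD lee_fin.
have -> : M * (M ^+ 2)^-1 + K / (4 * M) = (1 + K / 4) / M by field; rewrite gt_eqF.
rewrite /M invfM invrK mulrA divff ?mul1r// gt_eqF// ltr_pwDl// divr_ge0//.
Qed.

End bounded_increments.

Section density.
Context {R : realType}.
Notation mu := (@lebesgue_measure R).
Notation T := (measurableTypeR R).

(** The Stieltjes measure is absolutely continuous, so G is the integral of its
Radon-Nikodym density h and has derivative h almost everywhere. As G grows by 1
on ]-1, c], the density cannot vanish almost everywhere there. *)
Lemma cdf_density (G : cumulativeBounded (0 : R) (1 : R)) (K c : R) : 0 <= K ->
  (forall d, 0 < d -> exists r, [/\ 0 < r, r < d &
    (\int[mu]_x ((G (x + r) - G x) ^+ 2)%:E <= (K * r ^+ 2)%:E)%E]) ->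
  -1 <= c -> G (-1) = 0 -> G c = 1 ->
  exists h : R -> R, [/\ measurable_fun setT h,
    {ae mu, forall x, derivable G x 1 /\ (G : R -> R)^`()%classic x = h x} &
    (0 < mu ([set x | 0 < h x] `&` `]-1, c]%classic)%R)%E].
Proof.
move=> K0 increments c1 Gm1 Gc.
pose nu : {finite_measure set T -> \bar R} := lebesgue_stieltjes_measure G.
have dom : nu `<< mu.
  by apply/null_content_dominatesP => N mN; exact: (nu_null G K increments N K0 mN).
have [f [f0 ffin fint nuE]] := radon_nikodym_sigma_finite dom.
pose h x := fine (f x).
have hf x : (h x)%:E = f x by rewrite /h fineK.
have h0 x : 0 <= h x by rewrite /h fine_ge0.
have hint : mu.-integrable setT (EFin \o h).
  by apply: eq_integrable fint => // x _; rewrite /= hf.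
have mh : measurable_fun setT h.
  by have /integrableP[/measurable_EFinP] := hint.
exists h; split => //.
  have loc : locally_integrable setT h by apply: open_integrable_locally => //; exact: openT.
  have hi y : mu.-integrable `]-oo, y] (EFin \o h) by exact: integrableS hint.
  have GE : G = (fun x => \int[mu]_(t in `]-oo, x]) h t)%R :> (R -> R).
    apply/funext => x; rewrite /Rintegral.
    rewrite (_ : (\int[mu]_(t in `]-oo, x]) (h t)%:E)%E = nu `]-oo, x]%classic); last first.
      by rewrite nuE//; apply: eq_integral => t _; rewrite hf.
    have := cdf_lebesgue_stieltjes_id G x.
    rewrite /cdf /distribution /pushforward /= preimage_id => ->.
    by [].
  move: (FTC1Ny hi loc); rewrite /= -GE; apply: filterS.
  exact: (ae_filter_ringOfSetsType mu).
by move=> x [].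
rewrite lt_neqAle measure_ge0 andbT eq_sym; apply/eqP => A0.
have : nu `]-1, c]%classic = 1%E by rewrite /nu /= stieltjes_itv_oc// Gm1 Gc subr0.
rewrite nuE// => /eqP; rewrite (_ : (\int[mu]_(x in _) f x)%E = 0%E).
  by rewrite eq_sym onee_eq0.
have mE : measurable (`]-1, c]%classic : set T) by [].
have mf : measurable_fun (`]-1, c]%classic : set T) f.
  by have /integrableP[+ _] := fint; apply: measurable_funS.
pose E : set T := `]-1, c]%classic.
transitivity (\int[mu]_(x in E) (cst 0%E x))%E; last exact: integral0.
apply: ae_eq_integral => //.
exists ([set x | 0 < h x] `&` `]-1, c]%classic); split => //.
  apply: measurableI => //; rewrite -[X in measurable X]setTI.
  rewrite (_ : [set x | _] = h @^-1` `]0, +oo[%classic); first exact: mh.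
  by apply/seteqP; split => x /=; rewrite in_itv/= andbT.
move=> x /= /not_implyP[xE fx]; split => //; rewrite lt_neqAle h0 andbT eq_sym.
by apply/eqP => hx; apply: fx; rewrite -hf hx.
Qed.

End density.

(** * A zero-one law for backward orbits *)
Section zero_one.
Context {R : realType}.
Notation mu := (@lebesgue_measure R).
Variable b : R.
Hypothesis b_gt1 : 1 < b.
Hypothesis b_lt2 : b < 2.
Let c : R := (b - 1)^-1.

Let b_gt0 : 0 < b. Proof. exact: lt_trans b_gt1. Qed.
Let bn_gt0 n : 0 < b ^+ n. Proof. exact: exprn_gt0. Qed.
Let c_gt0 : 0 < c. Proof. by rewrite invr_gt0 subr_gt0. Qed.

Fixpoint hit (A : set R) (n : nat) : set R :=
  if n is n'.+1 then
    [set x | hit A n' (b * x)] `|` [set x | hit A n' (b * x - 1)]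
  else A.

Lemma measurable_hit (A : set R) n : measurable A -> measurable (hit A n).
Proof.
move=> mA; elim: n => //= n IH; apply: measurableU.
  have m : measurable_fun setT (fun x : R => b * x) by apply: measurable_funM.
  by have := m measurableT _ IH; rewrite setTI.
have m : measurable_fun setT (fun x : R => b * x - 1).
  by apply: measurable_funB => //; apply: measurable_funM.
by have := m measurableT _ IH; rewrite setTI.
Qed.

(** P is the value of the first n greedy digits of x, and y -> b^n (y - P)
follows the same branches as x. *)
Lemma cylinder (A : set R) n x : in_interval b x ->
  exists P, in_interval b (b ^+ n * (x - P)) /\
    forall y, A (b ^+ n * (y - P)) -> hit A n y.
Proof.
elim: n x => [|n IH] x xI.
  by exists 0; rewrite expr0 mul1r subr0; split => // y; rewrite mul1r subr0.
pose a : bool := 1 <= b * x.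
have xI' : in_interval b (b * x - a%:R) := greedy_in_interval b b_gt1 b_lt2 x 1 xI.
have [P [hP hA]] := IH _ xI'; exists ((P + a%:R) / b).
have E y : b ^+ n.+1 * (y - (P + a%:R) / b) = b ^+ n * (b * y - a%:R - P).
  by rewrite exprS; field; rewrite gt_eqF.
rewrite E; split => // y; rewrite E => /hA.
by rewrite /a; case: (1 <= b * x) => /= h; [right|left; rewrite subr0 in h].
Qed.

(** A point x that never meets A under the branches lies in the complement of
the set of points that do, and for every n a copy of A scaled by b^-n sits
within distance (c + 1) b^-n of x, inside that set. The complement therefore
misses a fixed proportion of small balls around x, which by the Lebesgue
density theorem happens for almost no x. *)
Lemma ae_hit (A : set R) : measurable A -> (0 < mu (A `&` `]-1, c]%classic)%R)%E ->
  {ae mu, forall x, in_interval b x -> exists n, hit A n x}.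
Proof.
move=> mA A0; pose A' : set R := A `&` `]-1, c]%classic.
have mA' : measurable A' by exact: measurableI.
have th_fin : (mu A' <= (c + 1)%:E)%E.
  apply: (@le_trans _ _ (mu `]-1, c]%classic)).
    by apply: le_measure; rewrite ?inE//; exact: subIsetr.
  rewrite lebesgue_measure_itv/=; case: ifP => _; rewrite -?EFinB lee_fin ?opprK//.
  by rewrite addr_ge0// ltW.
have [th thE] : exists th : R, mu A' = th%:E.
  exists (fine (mu A')); rewrite fineK// ge0_fin_numE//.
  exact: le_lt_trans th_fin (ltry _).
have th0 : 0 < th by rewrite -lte_fin -thE.
pose U : set R := \bigcup_n hit A n.
have mU : measurable U by apply: bigcup_measurable => n _; exact: measurable_hit.
have mZ : measurable (~` U) by exact: measurableC.
move: (lebesgue_density mZ); apply: filterS.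
  exact: (ae_filter_ringOfSetsType mu).
move=> x dens xI; apply: contrapT => nhit.
have Zx : (~` U) x by move=> [n _ hn]; apply: nhit; exists n.
rewrite indicE mem_set//= in dens.
pose rad n : R := (c + 1) / b ^+ n.
have rad0 n : 0 < rad n by rewrite divr_gt0// addr_gt0.
have radcvg : rad n @[n --> \oo] --> (0 : R).
  rewrite -(mulr0 (c + 1)); apply: cvgMr.
  rewrite (_ : (fun n => _) = fun n => b^-1 ^+ n); last first.
    by apply/funext => n; rewrite exprVn.
  by apply: cvg_expr; rewrite ger0_norm ?invr_ge0 ?ltW// invf_lt1.
have ratio n : (mu (~` U `&` ball x (rad n)) / mu (ball x (rad n)) <=
   (1 - th / (2 * (c + 1)))%:E)%E.
  have [P [hP hA]] := cylinder A n x xI.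
  pose C : set R := (fun y => b ^+ n * y + (- (b ^+ n * P))) @^-1` A'.
  have CE y : b ^+ n * y + (- (b ^+ n * P)) = b ^+ n * (y - P) by rewrite mulrBr.
  have mC : measurable C.
    have := measurable_affine (b ^+ n) (- (b ^+ n * P)).
    by move=> /(_ measurableT _ mA'); rewrite setTI.
  have muC : mu C = (th / b ^+ n)%:E.
    by rewrite lebesgue_measure_affine// thE -EFinM mulrC.
  have CU : C `<=` U.
    by move=> y []; rewrite CE => Ay _; exists n => //; exact: hA.
  have CB : C `<=` ball x (rad n).
    move=> y [_ /=]; rewrite CE in_itv/= => /andP[y1 y2].
    move: hP => /andP[x1 x2].
    have bnn : b ^+ n * `|x - y| < c + 1.
      rewrite -[b ^+ n]gtr0_norm// -normrM.
      rewrite (_ : b ^+ n * (x - y) = b ^+ n * (x - P) - b ^+ n * (y - P)); last by ring.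
      move: x1 x2 y1 y2; rewrite -/c; move: (b ^+ n * (x - P)) (b ^+ n * (y - P)) => u v *.
      by rewrite ltr_norml; apply/andP; split; have := c_gt0; lra.
    by rewrite /ball/= /rad ltr_pdivlMr// mulrC.
  have muB : mu (ball x (rad n)) = (rad n *+ 2)%:E.
    by rewrite lebesgue_measure_ball// ltW.
  have le1 : (mu (~` U `&` ball x (rad n)) + mu C <= mu (ball x (rad n)))%E.
    rewrite -measureU//; last 2 first.
    - by apply: measurableI => //; exact: measurable_ball.
    - by apply/seteqP; split => // y [[nU _] /CU].
    apply: le_measure; rewrite ?inE.
    - by apply: measurableU => //; apply: measurableI => //; exact: measurable_ball.
    - exact: measurable_ball.
    - by move=> y [[]|/CB].
  have B0 : 0 < rad n *+ 2 by rewrite pmulrn_lgt0.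
  rewrite muB inver gt_eqF// lee_pdivrMr//.
  move: le1; rewrite muC muB -leeBrDr// -EFinB => /le_trans; apply.
  rewrite -EFinM lee_fin le_eqVlt; apply/orP; left; apply/eqP.
  rewrite /rad -mulr_natr; field; rewrite gt_eqF//= gt_eqF// addr_gt0//.
have lim1 : (mu (~` U `&` ball x (rad n)) / mu (ball x (rad n)) @[n --> \oo] --> 1)%E.
  by move/cvge_at_rightP : dens; apply; split.
have := cvg_lim _ lim1 => /(_ (@ereal_hausdorff R)) limE.
have : (1 <= (1 - th / (2 * (c + 1)))%:E)%E.
  rewrite -limE; apply: lime_le; first by apply/cvg_ex; exists 1%E.
  by apply: nearW.
rewrite lee_fin leNgt => /negP; apply; rewrite gtrBl.
by rewrite divr_gt0// mulr_gt0// addr_gt0.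
Qed.

End zero_one.

(** * Exponential growth of the number of words *)
Section growth.
Context {R : realType}.
Notation mu := (@lebesgue_measure R).
Variable b : R.
Hypothesis b_gt1 : 1 < b.
Hypothesis b_lt2 : b < 2.
Let c : R := (b - 1)^-1.

Let b_gt0 : 0 < b. Proof. exact: lt_trans b_gt1. Qed.
Let bn_gt0 n : 0 < b ^+ n. Proof. exact: exprn_gt0. Qed.
Let c_gt0 : 0 < c. Proof. by rewrite invr_gt0 subr_gt0. Qed.

Lemma cvg_invpow : b ^- n @[n --> \oo] --> (0 : R).
Proof.
rewrite (_ : (fun n => _) = fun n => b^-1 ^+ n); last first.
  by apply/funext => n; rewrite exprVn.
by apply: cvg_expr; rewrite ger0_norm ?invr_ge0 ?ltW// invf_lt1.
Qed.

(** The quotient is s times the difference quotient of f for the increment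
s b^-n. *)
Lemma increment_quotient (f : R -> R) (x s : R) : derivable f x 1 ->
  b ^+ n * (f (x + s / b ^+ n) - f x) @[n --> \oo] --> s * f^`()%classic x.
Proof.
move=> df; have [->|s0] := eqVneq s 0.
  rewrite mul0r (_ : (fun n => _) = fun=> 0); first exact: cvg_cst.
  by apply/funext => n; rewrite mul0r addr0 subrr mulr0.
have fx : h^-1 *: (f (h + x) - f x) @[h --> 0^'] --> f^`()%classic x.
  rewrite derive1E (_ : (fun h : R => _) =
    fun h : R => h^-1 *: ((f \o shift x) (h *: (1 : R)) - f x)); first exact: df.
  by apply/funext => h /=; rewrite [h%:A]mulr1.
have sn : s / b ^+ n @[n --> \oo] --> (0 : R).
  by rewrite -(mulr0 s); apply: cvgMr; exact: cvg_invpow.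
have sn0 n : s / b ^+ n != 0 by rewrite mulf_neq0// invr_eq0 gt_eqF.
move/cvgr_dnbhsP: fx => /(_ (fun n => s / b ^+ n) (conj sn0 sn)) h.
rewrite (_ : (fun n => _) = fun n => s * ((s / b ^+ n)^-1 *: (f (s / b ^+ n + x) - f x))).
  exact: cvgMr.
apply/funext => n; rewrite /GRing.scale/= mulrA; congr (_ * _); last by rewrite [x + _]addrC.
by field; rewrite ?s0 ?gt_eqF//=.
Qed.

Let ratio_pow n : (2 / b) ^+ n = 2 ^+ n / b ^+ n :> R.
Proof. by rewrite exprMn exprVn. Qed.

(** The upper bound is an increment of F over length 3 c b^-n, hence a bounded
multiple of b^-n where F is differentiable. *)
Lemma branch_count_growth_le x : derivable (bcdf b) x 1 ->
  exists2 C, 0 < C & \forall n \near \oo, branch_count b n x <= C * (2 / b) ^+ n.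
Proof.
move=> dF; set D := (bcdf b)^`()%classic x.
have h1 := increment_quotient _ x c dF; have h2 := increment_quotient _ x (- (2 * c)) dF.
have h : b ^+ n * (bcdf b (x + c / b ^+ n) - bcdf b x) -
    b ^+ n * (bcdf b (x + - (2 * c) / b ^+ n) - bcdf b x) @[n --> \oo] -->
    c * D - - (2 * c) * D by exact: cvgB.
exists (`|c * D - - (2 * c) * D| + 1); first by rewrite ltr_wpDl.
have lt1 : c * D - - (2 * c) * D < `|c * D - - (2 * c) * D| + 1.
  by rewrite (le_lt_trans (ler_norm _))// ltrDl.
near=> n; have := branch_count_upper b b_gt1 b_lt2 n x; rewrite -/c => /le_trans; apply.
have : b ^+ n * (bcdf b (x + c / b ^+ n) - bcdf b x) -
    b ^+ n * (bcdf b (x + - (2 * c) / b ^+ n) - bcdf b x)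
   <= `|c * D - - (2 * c) * D| + 1.
  by near: n; apply: filterS (cvgr_lt _ h _ lt1) => n /ltW.
have key (u v w : R) : b ^+ n * (u - v) - b ^+ n * (w - v) = b ^+ n * (u - w) by ring.
rewrite key => hn; rewrite ratio_pow mulrCA ler_pM2l ?exprn_gt0// ler_pdivlMr// mulrC.
exact: hn.
Unshelve. all: by end_near. Qed.

Definition grows x := exists2 C, 0 < C &
  \forall n \near \oo, C * (2 / b) ^+ n <= branch_count b n x.

(** Multiplied by b^n, the lower bound tends to (e - F(e)(e + c)) F'(x), and e is
chosen so that the first factor is positive. *)
Lemma grows_derivative x : derivable (bcdf b) x 1 ->
  0 < (bcdf b)^`()%classic x -> grows x.
Proof.
move=> dF; set D := (bcdf b)^`()%classic x => D0.
have [e e0 Fe] := bcdf_small b b_gt1 b_lt2.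
have h1 := increment_quotient _ x e dF; have h2 := increment_quotient _ x (e + c) dF.
pose q := (e - bcdf b e * (e + c)) * D.
have q0 : 0 < q by rewrite mulr_gt0// subr_gt0.
have h : b ^+ n * (bcdf b (x + e / b ^+ n) - bcdf b x) -
    bcdf b e * (b ^+ n * (bcdf b (x + (e + c) / b ^+ n) - bcdf b x)) @[n --> \oo] -->
    e * D - bcdf b e * ((e + c) * D) by apply: cvgB => //; exact: cvgMr.
have qE : e * D - bcdf b e * ((e + c) * D) = q by rewrite /q; ring.
exists (q / 2); first by rewrite divr_gt0.
have lt1 : q / 2 < e * D - bcdf b e * ((e + c) * D) by rewrite qE; lra.
near=> n.
have : q / 2 <= b ^+ n * (bcdf b (x + e / b ^+ n) - bcdf b x) -
    bcdf b e * (b ^+ n * (bcdf b (x + (e + c) / b ^+ n) - bcdf b x)).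
  by near: n; apply: filterS (cvgr_gt _ h _ lt1) => n /ltW.
have := branch_count_lower b b_gt1 b_lt2 e n x (ltW e0); rewrite -/c.
move: (bcdf b (x + e / b ^+ n) - bcdf b x)
  (bcdf b (x + (e + c) / b ^+ n) - bcdf b x) => u v h3 h4.
rewrite ratio_pow mulrCA; apply: le_trans (_ : 2 ^+ n * (u - bcdf b e * v) <= _); last first.
  rewrite mulrBr lerBlDr; apply: (le_trans h3).
  by rewrite lerD2l mulrCA.
rewrite ler_pM2l ?exprn_gt0// ler_pdivrMr//; apply: (le_trans h4).
by rewrite le_eqVlt; apply/orP; left; apply/eqP; ring.
Unshelve. all: by end_near. Qed.

(** One more letter costs only the constant factor 2/b. *)
Lemma grows_pullback x y :
  (forall n, branch_count b n y <= branch_count b n.+1 x) -> grows y -> grows x.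
Proof.
move=> xy [C C0 [N _ hN]]; exists (C * (b / 2)); first by rewrite !mulr_gt0// divr_gt0.
exists N.+1 => // -[|n] //= Nn; apply: le_trans (xy n); apply: le_trans (hN n Nn).
rewrite exprS mulrA -[C * (b / 2) * _]mulrA (_ : b / 2 * (2 / b) = 1) ?mulr1//.
by field; rewrite gt_eqF.
Qed.

Lemma grows_hit (A : set R) n x : (forall y, A y -> grows y) -> hit b A n x -> grows x.
Proof.
move=> hA; elim: n x => [|n IH] x; first exact: hA.
case=> /= /IH; apply: grows_pullback => m; rewrite branch_countS ?lerDl ?lerDr//.
- by rewrite branch_count_ge0.
- by rewrite branch_count_ge0.
Qed.

Lemma growth_rate_cvg x : grows x -> derivable (bcdf b) x 1 ->
  growth_rate x b n @[n --> \oo] --> ln (2 / b).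
Proof.
move=> [C1 C10 lo] /branch_count_growth_le[C2 C20 up].
have b20 : 0 < 2 / b by rewrite divr_gt0.
have inv0 : (n%:R)^-1 @[n --> \oo] --> (0 : R).
  by rewrite -(cvg_shiftS (fun n => n%:R^-1 : R)); exact: cvg_harmonic.
have lim (C : R) : n%:R^-1 * ln C + ln (2 / b) @[n --> \oo] --> ln (2 / b).
  rewrite -[X in _ --> X]add0r; apply: cvgD; last exact: cvg_cst.
  by rewrite -(mul0r (ln C)); exact: cvgMl.
have lnE (C : R) n : 0 < C -> (0 < n)%N ->
    n%:R^-1 * ln C + ln (2 / b) = n%:R^-1 * ln (C * (2 / b) ^+ n).
  move=> C0 n0; rewrite lnM ?posrE ?exprn_gt0// lnXn// mulrDr; congr (_ + _).
  by rewrite -[ln _ *+ n]mulr_natl mulKf// pnatr_eq0 -lt0n.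
apply: (squeeze_cvgr _ (lim C1) (lim C2)).
near=> n.
have n0 : (0 < n)%N by near: n; exists 1%N.
have hlo : C1 * (2 / b) ^+ n <= branch_count b n x by near: n.
have hup : branch_count b n x <= C2 * (2 / b) ^+ n by near: n.
rewrite /growth_rate prefix_countE// !lnE//.
have l0 : 0 < C1 * (2 / b) ^+ n by rewrite mulr_gt0// exprn_gt0.
have c0 := lt_le_trans l0 hlo.
have i0 : 0 <= n%:R^-1 :> R by rewrite invr_ge0.
by apply/andP; split; apply: ler_wpM2l => //; rewrite ler_ln ?posrE//;
  exact: lt_le_trans hup.
Unshelve. all: by end_near. Qed.

Lemma bcdf_cvgNy : bcdf b @ -oo --> (0 : R).
Proof.
have cst_cvg : (fun=> 0 : R) x @[x --> (-oo : set_system R)] --> (0 : R) by exact: cvg_cst.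
apply: cvg_trans cst_cvg; apply: near_eq_cvg; near=> x.
by rewrite bcdf_neg//; near: x; exact: nbhs_ninfty_lt.
Unshelve. all: by end_near. Qed.

Lemma bcdf_cvgy : bcdf b @ +oo --> (1 : R).
Proof.
have cst_cvg : (fun=> 1 : R) x @[x --> (+oo : set_system R)] --> (1 : R) by exact: cvg_cst.
apply: cvg_trans cst_cvg; apply: near_eq_cvg; near=> x.
by rewrite bcdf_one//; near: x; exact: nbhs_pinfty_ge.
Unshelve. all: by end_near. Qed.

Lemma bcdf_cumulative : exists G : cumulativeBounded (0 : R) (1 : R), G = bcdf b :> (R -> R).
Proof.
pose m1 := isCumulative.Build R _ R (bcdf b) (bcdf_homo b b_gt1)
  (bcdf_right_continuous b b_gt1).
pose m2 := isCumulativeBounded.Build R 0 1 (bcdf b) bcdf_cvgNy bcdf_cvgy.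
pose G : cumulativeBounded (0 : R) (1 : R) := HB.pack (bcdf b) m1 m2.
by exists G.
Qed.

(** Growth holds where F has a positive derivative, and so, by pulling back, at
almost every point of the interval. *)
Lemma ae_growth_rate_cvg :
  (exists p D, [/\ (0 < p)%N, (1 < D)%N & exists K, forall m0,
    exists2 m, (m0 <= m)%N & energy p D m b <= K]) ->
  {ae mu, forall x, beta_interval b x ->
    growth_rate x b n @[n --> \oo] --> ln (2 / b)}.
Proof.
move=> [p [D [p0 D1 en]]].
have [K K0 inc] := increment_energy b b_gt1 b_lt2 p D p0 D1 en.
have [G GE] := bcdf_cumulative.
have [|||||h [mh [N [mN N0 hN]] pos]] := @cdf_density R G K c.
- exact: K0.
- by move=> d d0; rewrite GE; exact: inc.
- by rewrite (le_trans _ (ltW c_gt0))// lerN10.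
- by rewrite GE bcdf_neg// ltrN10.
- by rewrite GE bcdf_one.
pose A : set R := [set x | 0 < h x] `\` N.
have mpos : measurable [set x | 0 < h x].
  rewrite -[X in measurable X]setTI (_ : [set x | _] = h @^-1` `]0, +oo[%classic).
    exact: mh.
  by apply/seteqP; split => x /=; rewrite in_itv/= andbT.
have mA : measurable A by exact: measurableD.
have Apos : (0 < mu (A `&` `]-1, c]%classic)%R)%E.
  apply: (lt_le_trans pos).
  apply: (@le_trans _ _ (mu ((A `&` `]-1, c]%classic) `|` N))).
    apply: le_measure; rewrite ?inE.
    - exact: measurableI.
    - by apply: measurableU => //; exact: measurableI.
    - move=> x [hx xc]; have [Nx|Nx] := pselect (N x); first by right.
      by left.
  apply: (le_trans (measureU2 _ _ _)) => //; first exact: measurableI.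
  by rewrite [X in (_ + X)%E](_ : _ = 0%E) ?adde0.
have Agrows y : A y -> grows y.
  move=> [/= hy Ny]; have [dG dGh] : derivable G y 1 /\ (G : R -> R)^`()%classic y = h y.
    by apply: contrapT => /hN.
  by apply: grows_derivative; rewrite -GE ?dGh.
have good : {ae mu, forall x, derivable (bcdf b) x 1}.
  exists N; split => // x /= nd; apply: hN => -[dG _]; apply: nd.
  by rewrite -GE.
move: (ae_hit b b_gt1 b_lt2 A mA Apos) good; apply: filterS2.
  exact: (ae_filter_ringOfSetsType mu).
move=> x hx dF xI.
have xI' : in_interval b x.
  by move: xI => /set_mem; rewrite /= in_itv.
have [n hn] := hx xI'.
exact: growth_rate_cvg (grows_hit A n x Agrows hn) dF.
Qed.

End growth.

Theorem corollary2p1 (R : realType) :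
  {ae (@lebesgue_measure R), forall beta : R, 1 < beta < 2 ->
     {ae (@lebesgue_measure R), forall x : R, beta_interval beta x ->
        limn_esup (fun n : nat => (growth_rate x beta n)%:E)
          = (ln (2 / beta))%:E}}
  /\
  {ae (@lebesgue_measure R), forall beta : R, 1 < beta < Num.sqrt 2 ->
     {ae (@lebesgue_measure R), forall x : R, beta_interval beta x ->
        growth_rate x beta n @[n --> \oo] --> ln (2 / beta)}}.
Proof.
(* The limit exists for almost every base below 2; both parts follow. *)
have strong : {ae (@lebesgue_measure R), forall beta : R, 1 < beta < 2 ->
     {ae (@lebesgue_measure R), forall x : R, beta_interval beta x ->
        growth_rate x beta n @[n --> \oo] --> ln (2 / beta)}}.
  move: (@ae_energy_bounded R); apply: filterS.
    exact: (ae_filter_ringOfSetsType (@lebesgue_measure R)).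
  by move=> b hb b12; have /andP[b1 b2] := b12; exact: ae_growth_rate_cvg (hb b12).
split; move: strong; apply: filterS.
- exact: (ae_filter_ringOfSetsType (@lebesgue_measure R)).
- move=> b hb /hb; apply: filterS.
    exact: (ae_filter_ringOfSetsType (@lebesgue_measure R)).
  move=> x hx /hx lim.
  have lime : (growth_rate x b n)%:E @[n --> \oo] --> (ln (2 / b))%:E.
    by apply: cvg_EFin => //; exact: nearW.
  rewrite is_cvg_limn_esupE; last by apply/cvg_ex; exists (ln (2 / b))%:E.
  exact/cvg_lim.
- exact: (ae_filter_ringOfSetsType (@lebesgue_measure R)).
- move=> b hb /andP[b1 b2]; apply: hb; rewrite b1/=; apply: (lt_le_trans b2).
  apply: (@le_trans _ _ (Num.sqrt (2 ^+ 2))); last by rewrite sqrtr_sqr ger0_norm.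
  by apply: ler_wsqrtr; lra.
Qed.
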